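(* Assume $\mathfrak{p}=\mathfrak{c}>\omega_1$. Then no nonreflexive Grothendieck Banach space whose density is a regular cardinal (in particular, of density equal to $\mathfrak{c}$) admits an overcomplete set.
   Context: All Banach spaces are infinite dimensional and over the reals. $dens(X)$ (the density) is the minimal cardinality of a norm dense subset of $X$. A subset $Y$ of a Banach space $X$ is called overcomplete (in $X$) if $|Y|=dens(X)$ and every $Z\subseteq Y$ with $|Z|=|Y|$ is linearly dense in $X$ (its linear span is norm dense in $X$). $X$ is a Grothendieck space if weakly$^*$ convergent sequences in $X^*$ coincide with weakly convergent sequences. $\mathfrak{c}=|\mathbb{R}|$, and $\mathfrak{p}$ is the pseudointersection number: the minimal cardinality of a family $\mathcal{F}$ of subsets of $\mathbb{N}$ such that all finite subfamilies of $\mathcal{F}$ have infinite intersection but there is no infinite $A\subseteq\mathbb{N}$ with $A\setminus F$ finite for all $F\in\mathcal{F}$. *)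

(* Defs.v *)
From HB Require Import structures.
From mathcomp Require Import all_boot all_order all_algebra.
From mathcomp Require Import all_classical all_reals all_analysis.
From mathcomp Require wochoice.
Import Order.TTheory GRing.Theory Num.Theory.
Import numFieldNormedType.Exports.

Set Implicit Arguments.
Unset Strict Implicit.
Unset Printing Implicit Defensive.

Local Open Scope classical_set_scope.
Local Open Scope card_scope.
Local Open Scope ring_scope.

Section Cardinals.

Definition card_lt (T U : Type) (A : set T) (B : set U) : Prop :=
  (A #<= B) /\ ~ (B #<= A).

Definition is_aleph1 (T : Type) (W : set T) : Prop :=
  ~ countable W /\
  forall (U : Type) (A : set U), ~ countable A -> W #<= A.

(* (K, le) is well ordered and all its proper initial segments have smaller
   cardinality, i.e. its order type is the initial ordinal |K|. *)
Definition initial_well_order (T : Type) (K : set T) (le : rel T) : Prop :=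
  wochoice.wo_chain le (mem K) /\
  forall x, K x -> card_lt [set y | [/\ K y, le y x & y <> x]] K.

Definition cofinal (T : Type) (K : set T) (le : rel T) (C : set T) : Prop :=
  C `<=` K /\ forall x, K x -> exists2 y, C y & le x y.

(* cf |K| = |K| *)
Definition regular_cardinal (T : Type) (K : set T) : Prop :=
  infinite_set K /\
  exists le : rel T, initial_well_order K le /\
    forall C, cofinal K le C -> C #= K.

Definition strong_fip (F : set (set nat)) : Prop :=
  forall G, G `<=` F -> finite_set G -> infinite_set (\bigcap_(A in G) A).

Definition pseudointersection (F : set (set nat)) (A : set nat) : Prop :=
  infinite_set A /\ forall B, F B -> finite_set (A `\` B).

(* |K| is the cardinal p *)
Definition is_pseudointersection_number (T : Type) (K : set T) : Prop :=
  let bad F := strong_fip F /\ ~ exists A, pseudointersection F A in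
  (exists2 F, bad F & F #= K) /\ forall F, bad F -> K #<= F.

End Cardinals.

Section Dual.
Context {R : realType} (X : normedModType R).

Definition dual_pred : {pred X -> R^o} :=
  [pred f | `[< linear f /\ continuous f >] ].

Lemma dual_pred_submod_closed : submod_closed dual_pred.
Proof.
split.
  apply/asboolP; split; last exact: cst_continuous.
  by move=> a u v; rewrite /= scaler0 addr0.
move=> a f g /asboolP[lf cf] /asboolP[lg cg]; apply/asboolP; split.
  move=> b u v; rewrite !fctE lf lg !scalerDr !scalerA (mulrC a b).
  by rewrite addrACA.
move=> x; apply: (@cvgD _ _ _ (nbhs x)); last exact: cg.
by apply: cvgZr; exact: cf.
Qed.

HB.instance Definition _ := GRing.isSubmodClosed.Build _ _ dual_pred
  dual_pred_submod_closed.

Record dual := Dual {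
  dual_fun :> X -> R^o;
  _ : dual_fun \in dual_pred }.

HB.instance Definition _ := [isSub for dual_fun].
HB.instance Definition _ := [Choice of dual by <:].
HB.instance Definition _ := [SubChoice_isSubLmodule of dual by <:].

Lemma dual_linear (f : dual) : linear f.
Proof. by case: f => f /= /asboolP[]. Qed.

Lemma dual_continuous (f : dual) : continuous f.
Proof. by case: f => f /= /asboolP[]. Qed.

HB.instance Definition _ (f : dual) :=
  GRing.isLinear.Build R X R^o _ f (dual_linear f).

Definition dual_norm (f : dual) : R :=
  sup [set `|f x| | x in [set x : X | `|x| <= 1]].

Let ball_img (f : dual) := [set `|f x| | x in [set x : X | `|x| <= 1]].

Let ball_img0 f : ball_img f !=set0.
Proof. by exists `|f 0|, 0; rewrite //= normr0. Qed.

Let ball_imgM f : has_ubound (ball_img f).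
Proof.
have /bounded_funP/(_ 1)[M Mf] :=
  continuous_linear_bounded 0 (@dual_continuous f 0).
by exists M => _ [x /= x1 <-]; exact: Mf.
Qed.

Lemma dual_norm_ub (f : dual) (x : X) : `|f x| <= dual_norm f * `|x|.
Proof.
have [->|x0] := eqVneq x 0; first by rewrite linear0 !normr0 mulr0.
have nx0 : 0 < `|x| by rewrite normr_gt0.
rewrite -ler_pdivrMr//.
have -> : `|f x| / `|x| = `|f (`|x|^-1 *: x)|.
  by rewrite linearZ/= normrZ normfV normr_id mulrC.
apply: ub_le_sup; first exact: ball_imgM.
by exists (`|x|^-1 *: x) => //=; rewrite normrZ normfV normr_id mulVf ?gt_eqF.
Qed.

Let dual_normD f g : dual_norm (f + g) <= dual_norm f + dual_norm g.
Proof.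
apply: ge_sup; first exact: ball_img0.
move=> _ [x /= x1 <-]; apply: (le_trans (ler_normD _ _)).
by apply: lerD; apply: ub_le_sup; [exact: ball_imgM|exists x
                                 |exact: ball_imgM|exists x].
Qed.


Let dual_norm_ge0 f : 0 <= dual_norm f.
Proof.
apply: (@le_trans _ _ `|f 0|) => //.
by apply: ub_le_sup; [exact: ball_imgM|exists 0; rewrite //= normr0].
Qed.

Let dual_normZ_le (a : R) f : dual_norm (a *: f) <= `|a| * dual_norm f.
Proof.
apply: ge_sup; first exact: ball_img0.
move=> _ [x /= x1 <-]; rewrite normrM ler_wpM2l//.
by apply: ub_le_sup; [exact: ball_imgM|exists x].
Qed.

Let dual_normZ (a : R) f : dual_norm (a *: f) = `|a| * dual_norm f.
Proof.
apply/eqP; rewrite eq_le dual_normZ_le/=.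
have [->|a0] := eqVneq a 0; first by rewrite normr0 mul0r dual_norm_ge0.
have := dual_normZ_le a^-1 (a *: f).
by rewrite scalerA mulVf// scale1r normfV ler_pdivlMl ?normr_gt0.
Qed.

Let dual_norm0_eq0 f : dual_norm f = 0 -> f = 0.
Proof.
move=> f0; apply/val_inj/funext => x; apply/eqP.
by have := dual_norm_ub f x; rewrite f0 mul0r normr_le0.
Qed.

HB.instance Definition _ := Lmodule_isNormed.Build R dual
  dual_normD dual_normZ dual_norm0_eq0.

End Dual.

Section BanachSpaces.
Context {R : realType} (X : normedModType R).

Definition linear_span (A : set X) : set X :=
  [set x | exists (n : nat) (a : 'I_n -> R) (v : 'I_n -> X),
    (forall i, A (v i)) /\ x = \sum_(i < n) a i *: v i].

Definition infinite_dimensional : Prop :=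
  forall A : set X, finite_set A -> linear_span A <> setT.

(* surjectivity of the canonical embedding of X into its bidual *)
Definition reflexive_space : Prop :=
  forall phi : dual (dual X), exists x : X, forall f : dual X, phi f = f x.

Definition weak_star_cvg (f : nat -> dual X) (l : dual X) : Prop :=
  forall x : X, (fun n => f n x) @ \oo --> l x.

Definition weak_cvg (V : normedModType R) (u : nat -> V) (l : V) : Prop :=
  forall phi : dual V, (fun n => phi (u n)) @ \oo --> phi l.

Definition grothendieck_space : Prop :=
  forall (f : nat -> dual X) (l : dual X),
    weak_star_cvg f l <-> weak_cvg f l.

(* dens(X) = |K| *)
Definition has_density (T : Type) (K : set T) : Prop :=
  (exists2 D : set X, dense D & D #= K) /\
  forall D : set X, dense D -> K #<= D.

Definition overcomplete (Y : set X) : Prop :=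
  has_density Y /\
  forall Z, Z `<=` Y -> Z #= Y -> dense (linear_span Z).

End BanachSpaces.

(* Main.v *)
(* Let X be nonreflexive Grothendieck. By Hahn-Banach there are Phi in X** and
   functionals f_n in the unit ball with Phi(f_n) = t > 0, such that f_n(x) is
   eventually 0 for a set of vectors x norming the span of the f_n. A weak limit
   of convex combinations of the f_n would lie in their closed span and vanish
   on those x, hence be 0, whereas Phi is t on it; so by the Grothendieck
   property no sequence of convex blocks of (f_n) converges weak*.

   First, if X had density smaller than p, a pseudointersection of the sets
   {n : |f_n(x) - lim_U f_n(x)| < 1/k}, with U a free ultrafilter and x in a
   dense set, would give a weak* convergent subsequence.

   Second (after Haydon, Levy and Odell), each block sequence mu can be split
   along some x: for two subsequences mu_(a i)(x), mu_(b i)(x) with distinct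
   limits, the averages of mu_(a i) and mu_(b i) form a new block sequence on
   which the function rho equal to 1 on the blocks of the former and to -1 on
   those of the latter is asymptotically orthogonal to every previous rho, while
   rho f(x) keeps a nonzero integral. Countably many steps can be diagonalized,
   so some increasing chain of splittings uses uncountably many pairs (rho, x).
   A limit M of the block sequences along ultrafilters is a finitely additive
   mean on the integers for which the rho are orthogonal, and by Bessel's
   inequality every x is annihilated by all but countably many of the nonzero
   functionals y |-> M(rho f(y)).

   Hence omega_1 nonzero functionals have zero sets covering X. If these all met
   Y in fewer than |Y| points, the cofinality of |Y| would be at most omega_1.
   This is excluded if |Y| > omega_1 is regular, and for |Y| = c by Koenig's
   theorem, as 2^omega_1 = c by Solovay's almost disjoint coding. *)
From HB Require Import structures.
Require Import Defs.
From mathcomp Require Import all_boot all_order all_algebra.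
From mathcomp Require Import all_classical all_reals all_analysis.
From mathcomp Require Import ring lra.
Import Order.TTheory GRing.Theory Num.Theory.
Import numFieldNormedType.Exports.
Local Open Scope classical_set_scope.
Local Open Scope ring_scope.

Set Implicit Arguments.
Unset Strict Implicit.
Unset Printing Implicit Defensive.

(** * Hahn-Banach theorem and duality *)

Section HahnBanach.
Context {R : realType} {V : lmodType R}.

Definition sublinear (p : V -> R) : Prop :=
  (forall u v, p (u + v) <= p u + p v) /\
  (forall t v, 0 < t -> p (t *: v) = t * p v).

(** Partial functionals are kept as graphs so that Zorn's lemma can take unions; domination by [p]
    already forces them to be single-valued. *)
Definition dominated_graph (p : V -> R) (G : V -> R -> Prop) : Prop :=
  [/\ G 0 0,
      forall t u v a b, G u a -> G v b -> G (t *: u + v) (t * a + b) &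
      forall v a, G v a -> a <= p v].

(** Two values at [v] would make every real a value at 0, whereas [p 0] bounds these. *)
Lemma dominated_graph_fun p G v a b :
  dominated_graph p G -> G v a -> G v b -> a = b.
Proof.
move=> [_ Gl Gp] Ga Gb.
have G0 c d : G v c -> G v d -> forall t, G 0 (t * (c - d)).
  move=> Gc Gd t.
  have /= h := Gl (-1) v v d c Gd Gc.
  have h2 := Gl (t - 1) _ _ _ _ h h.
  move: h2; rewrite !scaleN1r addNr scaler0 addr0.
  by have -> : (t - 1) * (-1 * d + c) + (-1 * d + c) = t * (c - d) by ring.
apply/eqP; rewrite -subr_eq0; apply/negPn/negP => ab0.
have := Gp _ _ (G0 a b Ga Gb ((p 0 + 1) / (a - b))).
rewrite -mulrA mulVf// mulr1; lra.
Qed.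

(** A value [c] at [v] is admissible when [a - p (u - v) <= c <= p (u + v) - a] for all [G u a].
    Subadditivity puts each lower bound below each upper bound; [c] is the supremum of the lower
    ones. *)
Lemma dominated_graph_extend p G v : sublinear p -> dominated_graph p G ->
  exists G', [/\ dominated_graph p G', (forall u a, G u a -> G' u a)
                & exists a, G' v a].
Proof.
move=> [pD pZ] [G0 Gl Gp].
pose L := [set z : R | exists u a, G u a /\ z = a - p (u - v)].
have Lub u a : G u a -> ubound L (p (u + v) - a).
  move=> Gu _ [w [b [Gw ->]]].
  have := Gl 1 _ _ _ _ Gu Gw; rewrite scale1r mul1r => /Gp.
  have := pD (u + v) (w - v).
  have -> : u + v + (w - v) = u + w by rewrite addrACA subrr addr0.
  lra.
pose c := sup L.
have cub u a : G u a -> c <= p (u + v) - a.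
  move=> Gu; apply: ge_sup; last exact: Lub.
  by exists (0 - p (0 - v)), 0, 0.
have clb u a : G u a -> a - p (u - v) <= c.
  move=> Gu; apply: ub_le_sup; first by exists (p (0 + v) - 0); exact: Lub.
  by exists u, a.
have GZ t u a : G u a -> G (t *: u) (t * a).
  by move=> Gu; have := Gl t _ _ _ _ Gu G0; rewrite !addr0.
exists (fun w d => exists u a t, [/\ G u a, w = u + t *: v & d = a + t * c]).
split; [split| |].
- by exists 0, 0, 0; rewrite scale0r mul0r !addr0.
- move=> s _ _ _ _ [u [a [t [Gu -> ->]]]] [u' [a' [t' [Gu' -> ->]]]].
  exists (s *: u + u'), (s * a + a'), (s * t + t'); split; first exact: Gl.
    by rewrite scalerDr scalerDl scalerA addrACA.
  ring.
- move=> _ _ [u [a [t [Gu -> ->]]]].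
  (* Rescaling [u] by [1 / |t|] reduces either sign of [t] to the bounds on [c]. *)
  have [t0|t0|->] := ltgtP t 0; last by rewrite scale0r mul0r !addr0; exact: Gp.
    have := clb _ _ (GZ (- t^-1) _ _ Gu).
    have nt0 : 0 < - t by rewrite oppr_gt0.
    have -> : p (u + t *: v) = (- t) * p ((- t^-1) *: u - v).
      rewrite -pZ// scalerBr scalerA mulrNN divff ?lt_eqF// scale1r.
      by rewrite scaleNr opprK.
    rewrite -(ler_pM2l nt0) mulrBr.
    have -> : - t * (- t^-1 * a) = a by rewrite mulrA mulrNN divff ?lt_eqF// mul1r.
    lra.
  have := cub _ _ (GZ (t^-1) _ _ Gu).
  have -> : p (u + t *: v) = t * p (t^-1 *: u + v).
    by rewrite -pZ// scalerDr scalerA divff ?gt_eqF// scale1r.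
  rewrite -(ler_pM2l t0) mulrBr.
  have -> : t * (t^-1 * a) = a by rewrite mulrA divff ?gt_eqF// mul1r.
  lra.
- by move=> u a Gu; exists u, a, 0; rewrite scale0r mul0r !addr0.
- by exists c, 0, 0, 1; rewrite scale1r mul1r !add0r.
Qed.

Lemma hahn_banach p G : sublinear p -> dominated_graph p G ->
  exists L : V -> R, [/\ linear (L : V -> R^o), (forall v, L v <= p v)
                     & forall v a, G v a -> L v = a].
Proof.
move=> psub Gdom.
pose rel_of (A : set (V * R)) v a := A (v, a).
pose P (A : set (V * R)) := A = set0 \/
  (forall v a, G v a -> A (v, a)) /\ dominated_graph p (rel_of A).
have [|A [PA Amax]] := @Zorn_bigcup _ P.
  move=> F FP Ftot.
  have [[B FB B0]|Fe] := pselect (exists2 B, F B & B !=set0); last first.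
    left; rewrite -subset0 => x [B FB Bx]; apply: Fe; exists B => //.
    by exists x.
  have FG C : F C -> C !=set0 ->
    (forall v a, G v a -> C (v, a)) /\ dominated_graph p (rel_of C).
    by move=> /FP[->[x//]|//].
  right; split.
    by move=> v a Gv; exists B => //; apply: (FG _ FB B0).1.
  split.
  - by exists B => //; have [_ []] := FG _ FB B0.
  - move=> t u v a b [C FC Cu] [D FD Dv].
    have C0 : C !=set0 by exists (u, a).
    have D0 : D !=set0 by exists (v, b).
    have [CD|DC] := Ftot _ _ FC FD.
      exists D => //; have [_ [_ Dl _]] := FG _ FD D0; apply: Dl => //.
      exact: CD.
    exists C => //; have [_ [_ Cl _]] := FG _ FC C0; apply: Cl => //.
    exact: DC.
  - move=> v a [C FC Cv]; have C0 : C !=set0 by exists (v, a).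
    by have [_ [_ _]] := FG _ FC C0; exact.
have {}PA : (forall v a, G v a -> A (v, a)) /\ dominated_graph p (rel_of A).
  case: PA => // A0; exfalso; apply: (Amax [set x | G x.1 x.2]).
    split; first by rewrite A0.
    by move=> /(_ (0, 0)) /=; rewrite A0; apply; case: Gdom.
  by right; split=> //; case: Gdom => *; split.
have Atot v : exists a, A (v, a).
  have [G' [G'dom AG' [a G'v]]] := dominated_graph_extend v psub PA.2.
  exists a; apply: contrapT => nAv.
  apply: (Amax [set x | G' x.1 x.2]).
    by split; [move=> [u b] /AG'|move/(_ (v, a) G'v)].
  right; split; first by move=> u b /PA.1/AG'.
  by case: G'dom => *; split.
have [L AL] := choice Atot.
exists L; split.
- move=> t u v; apply: (dominated_graph_fun PA.2 (AL _)).
  by have [_ [_ Al _]] := PA; apply: Al; exact: AL.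
- by move=> v; have [_ [_ _]] := PA; apply; exact: AL.
- by move=> v a Gv; apply: (dominated_graph_fun PA.2 (AL _)); exact: PA.1.
Qed.

End HahnBanach.

Lemma small_inverse {R : realType} (e : R) : 0 < e ->
  exists N : nat, N.+1%:R^-1 < e.
Proof.
by move=> e0; have [N _ /(_ N (leqnn N))] := near_infty_natSinv_lt (PosNum e0); exists N.
Qed.

Section Dual.
Context {R : realType} {X : normedModType R}.

Lemma bounded_functional (f : X -> R^o) (C : R) : linear f ->
  (forall x, `|f x| <= C * `|x|) -> exists g : dual X, g = f :> (X -> R^o).
Proof.
move=> fl fC.
have fB x y : f (x - y) = f x - f y.
  by rewrite addrC -scaleN1r fl scaleN1r addrC.
have fcont : continuous f.
  move=> x; apply/cvgrPdist_lt => e e0.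
  have C0 : 0 < `|C| + 1 by rewrite ltr_wpDl.
  near=> y; rewrite -fB (le_lt_trans (fC _))//.
  apply: (@le_lt_trans _ _ ((`|C| + 1) * `|x - y|)).
    by apply: ler_wpM2r => //; rewrite (le_trans (ler_norm _))// lerDl.
  rewrite mulrC -ltr_pdivlMr//; near: y.
  by apply: cvgr_dist_lt; rewrite ?divr_gt0.
have fP : f \in @dual_pred R X by apply/asboolP; split.
by exists (Dual fP).
Unshelve. all: by end_near. Qed.

Lemma dual_norm_le (f : dual X) (C : R) : 0 <= C ->
  (forall x, `|f x| <= C * `|x|) -> `|f| <= C.
Proof.
move=> C0 fC; apply: ge_sup; first by exists `|f 0|, 0; rewrite //= normr0.
move=> _ [x /= x1 <-]; rewrite (le_trans (fC x))//.
by rewrite -[leRHS]mulr1 ler_wpM2l.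
Qed.

Lemma dual_le (f : dual X) x : `|f x| <= `|f| * `|x|.
Proof. exact: dual_norm_ub. Qed.

Lemma dualD (f g : dual X) x : (f + g) x = f x + g x. Proof. by []. Qed.

Lemma dualN (f : dual X) x : (- f) x = - f x. Proof. by []. Qed.

Lemma dualZ (a : R) (f : dual X) x : (a *: f) x = a * f x. Proof. by []. Qed.

Lemma norming_vector (f : dual X) : exists x, `|x| <= 1 /\ `|f| / 2 <= f x.
Proof.
have [->|f0] := eqVneq f 0; first by exists 0; rewrite !normr0 mul0r linear0.
have nf0 : 0 < `|f| / 2 by rewrite divr_gt0// normr_gt0.
have [|_ [x /= x1 <-]] := sup_adherent nf0
    (E := [set `|f x| | x in [set x : X | `|x| <= 1]]).
  split; first by exists `|f 0|, 0; rewrite //= normr0.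
  exists `|f| => _ [x /= x1 <-]; rewrite (le_trans (dual_le f x))//.
  by rewrite -[leRHS]mulr1 ler_wpM2l.
have -> : sup [set `|f x| | x in [set x : X | `|x| <= 1]] = `|f| by [].
have [fx0|fx0] := ltrP (f x) 0.
  rewrite ltr0_norm// => fx.
  by exists (- x); rewrite normrN linearN; split=> //; lra.
by rewrite ger0_norm// => fx; exists x; split=> //; lra.
Qed.

Lemma norm_sublinear (t : R) : 0 <= t -> sublinear (fun x : X => t * `|x|).
Proof.
move=> t0; split; first by move=> u v; rewrite -mulrDr ler_wpM2l// ler_normD.
by move=> s v s0; rewrite normrZ gtr0_norm// mulrCA.
Qed.

Lemma dual_extension (G : X -> R -> Prop) (C : R) : 0 <= C ->
  dominated_graph (fun x : X => C * `|x|) G ->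
  exists f : dual X, `|f| <= C /\ forall v a, G v a -> f v = a.
Proof.
move=> C0 /(hahn_banach (norm_sublinear C0))[L [Ll Lp LG]].
have LC x : `|L x| <= C * `|x|.
  rewrite ler_norml Lp andbT lerNl.
  have := Lp (- x); rewrite normrN; congr (_ <= _).
  have := Ll (-2) x x; rewrite !scaleNr scaler_nat mulr2n opprD subrK => ->.
  rewrite /GRing.scale /=; lra.
have [f fL] := bounded_functional Ll LC.
by exists f; rewrite fL; split=> //; apply: dual_norm_le => // x; rewrite fL.
Qed.

Lemma norming_functional (x : X) : exists f : dual X, `|f| <= 1 /\ f x = `|x|.
Proof.
have [||f [f1 fx]] := @dual_extension (fun v a => exists t, v = t *: x /\ a = t * `|x|) 1.
- by [].
- split.
  + by exists 0; rewrite scale0r mul0r.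
  + move=> t _ _ _ _ [s [-> ->]] [r [-> ->]]; exists (t * s + r).
    by rewrite scalerDl scalerA mulrDl mulrA.
  + move=> _ _ [t [-> ->]]; rewrite mul1r normrZ ler_wpM2r//.
    exact: ler_norm.
- by exists f; split=> //; apply: fx; exists 1; rewrite scale1r mul1r.
Qed.

(** On the span of [g] and [G], sending [t *: g - u] to [t] has norm at most [1 / d], since
    [|t| d <= |t *: g - u|]. *)
Lemma separating_functional (G : set X) (g : X) (d : R) :
  G 0 -> (forall t u v, G u -> G v -> G (t *: u + v)) -> 0 < d ->
  (forall u, G u -> d <= `|g - u|) ->
  exists f : dual X, (forall u, G u -> f u = 0) /\ f g = 1.
Proof.
move=> G0 Gl d0 Gd.
have [||f [_ fP]] := @dual_extension
  (fun v a => exists t u, [/\ G u, v = t *: g - u & a = t]) d^-1.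
- by rewrite invr_ge0 ltW.
- split.
  + by exists 0, 0; rewrite scale0r subr0.
  + move=> t _ _ _ _ [s [u [Gu -> ->]]] [r [w [Gw -> ->]]].
    exists (t * s + r), (t *: u + w); split=> //; first exact: Gl.
    by rewrite scalerDl scalerBr scalerA opprD addrACA.
  + move=> _ _ [t [u [Gu -> ->]]].
    have [->|t0] := eqVneq t 0.
      by rewrite mulr_ge0// invr_ge0 ltW.
    have := Gd (t^-1 *: u).
    have Gtu : G (t^-1 *: u) by rewrite -[t^-1 *: u]addr0; exact: Gl.
    move=> /(_ Gtu) h.
    have -> : t *: g - u = t *: (g - t^-1 *: u).
      by rewrite scalerBr scalerA divff// scale1r.
    rewrite normrZ (le_trans (ler_norm _))// mulrCA ler_peMr//.
    by rewrite -(ler_pM2l d0) mulrA divff ?gt_eqF// mulr1 mul1r.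
- exists f; split; last by apply: fP; exists 1, 0; rewrite scale1r subr0.
  move=> u Gu; have := fP (- u) 0; rewrite linearN => h.
  apply/eqP; rewrite -oppr_eq0; apply/eqP; apply: h.
  by exists 0, u; rewrite scale0r sub0r.
Qed.

End Dual.

Section Bidual.
Context {R : realType} {X : completeNormedModType R}.

Lemma evaluation_functional (x : X) :
  exists e : dual (dual X), (forall f, e f = f x) /\ `|e| = `|x|.
Proof.
have [||e ex] := @bounded_functional R (dual X) (fun f : dual X => f x) `|x|.
- by move=> t f g.
- by move=> f; rewrite mulrC; exact: dual_le.
exists e; rewrite ex; split=> //; apply/eqP; rewrite eq_le; apply/andP; split.
  by apply: dual_norm_le => // f; rewrite ex mulrC; exact: dual_le.
have [f [f1 fx]] := norming_functional x.
have := dual_le e f; rewrite ex fx normr_id => /le_trans; apply.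
by rewrite -[leRHS]mulr1 ler_wpM2l.
Qed.

Definition evaluation (x : X) : dual (dual X) :=
  projT1 (cid (evaluation_functional x)).

Lemma evaluationE x f : evaluation x f = f x.
Proof. by rewrite /evaluation; case: cid => e [/= ->]. Qed.

Lemma evaluation_norm x : `|evaluation x| = `|x|.
Proof. by rewrite /evaluation; case: cid => e []. Qed.

Lemma evaluationB x y : evaluation (x - y) = evaluation x - evaluation y.
Proof.
apply/val_inj/funext => f.
rewrite -[LHS]/(evaluation (x - y) f) -[RHS]/(evaluation x f - evaluation y f).
by rewrite !evaluationE linearB.
Qed.

(* The canonical image of [X] is closed since it is isometric to a complete
   space. *)
Lemma bidual_distance (Phi : dual (dual X)) :
  (forall e, 0 < e -> exists x, `|Phi - evaluation x| < e) ->
  exists x, forall f, Phi f = f x.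
Proof.
move=> Phid.
have /choice[u uP] : forall n : nat, exists x, `|Phi - evaluation x| < n.+1%:R^-1.
  by move=> n; apply: Phid; rewrite invr_gt0.
have uB n m : (n <= m)%N -> `|u n - u m| < 2 * n.+1%:R^-1.
  move=> nm; rewrite -evaluation_norm evaluationB.
  have -> : evaluation (u n) - evaluation (u m) =
      (Phi - evaluation (u m)) - (Phi - evaluation (u n)).
    by rewrite opprB [RHS]addrC addrA subrK.
  rewrite (le_lt_trans (ler_normB _ _))// mulr_natl mulr2n ltrD ?uP//.
  by rewrite (lt_le_trans (uP m))// lef_pV2 ?posrE// ler_nat.
have ucvg : cvg (u @ \oo).
  apply/cauchy_cvgP; apply: cauchy_exP => e e0.
  have [N Ne] : exists N : nat, N.+1%:R^-1 < e / 2.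
    by apply: small_inverse; rewrite divr_gt0.
  exists (u N), N => // n /= Nn; rewrite -ball_normE /= (lt_trans (uB _ _ Nn))//.
  by rewrite mulrC -ltr_pdivlMr.
have /cvg_ex[x ux] := ucvg.
exists x; suff -> : Phi = evaluation x by move=> f; rewrite evaluationE.
apply/eqP; rewrite -subr_eq0 -normr_le0; apply/ler_addgt0Pr => e e0.
rewrite add0r; have e20 : 0 < e / 2 by rewrite divr_gt0.
have [N Ne] := small_inverse e20.
have /cvgrPdist_lt/(_ _ e20)[M _ Me] := ux.
have {}Me := Me (maxn N M) (leq_maxr _ _).
have -> : Phi - evaluation x =
    (Phi - evaluation (u (maxn N M))) - (evaluation (x - u (maxn N M))).
  by rewrite evaluationB opprB addrA subrK.
rewrite (le_trans (ler_normB _ _))// evaluation_norm.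
rewrite [leRHS]splitr lerD ?(ltW Me)// ltW// (lt_trans (uP _))//.
by rewrite (le_lt_trans _ Ne)// lef_pV2 ?posrE// ler_nat ltnS leq_maxl.
Qed.

(** Induction on [s]. If some [f0] vanishes on the tail but not at [x], subtracting
    [(f x / f0 x) *: f0] from [f] shows that [psi] minus a multiple of the evaluation at [x]
    satisfies the hypothesis for the tail; if there is none, vanishing at [x] is automatic. *)
Lemma finite_annihilator (psi : dual X -> R^o) (s : seq X) : linear psi ->
  (forall f : dual X, (forall x, x \in s -> f x = 0) -> psi f = 0) ->
  exists x, forall f : dual X, psi f = f x.
Proof.
elim: s psi => [|x s IH] psi psil ps.
  by exists 0 => f; rewrite linear0; apply: ps.
have psiD f g : psi (f + g) = psi f + psi g by rewrite -[f]scale1r psil !scale1r.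
have psi0 : psi 0 = 0.
  have /eqP := psiD 0 0.
  by rewrite addr0 -subr_eq0 opprD addrA subrr sub0r oppr_eq0 => /eqP.
have [[f0 [f0s f0x]]|nf0] := pselect (exists f0 : dual X,
    (forall y, y \in s -> f0 y = 0) /\ f0 x != 0); last first.
  apply: IH => // f fs; apply: ps => y; rewrite inE => /predU1P[->|/fs//].
  by apply: contrapT => fx; apply: nf0; exists f; split => //; exact/eqP.
pose c : R := psi f0 / f0 x.
have [||y yP] := IH (fun f : dual X => psi f - c * f x : R^o).
- move=> t f g; have -> : (t *: f + g) x = t * f x + g x by [].
  by rewrite psil /GRing.scale /=; ring.
- move=> f fs.
  have := ps (f - (f x / f0 x) *: f0).
  rewrite addrC -scaleNr psil => h.
  have {h} : (- (f x / f0 x) *: psi f0 + psi f = 0).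
    apply: h => y.
    have -> : (- (f x / f0 x) *: f0 + f) y = - (f x / f0 x) * f0 y + f y by [].
    rewrite inE => /predU1P[->|ys].
      by rewrite mulNr divfK ?addNr.
    by rewrite (f0s _ ys) (fs _ ys) mulr0 addr0.
  rewrite /GRing.scale /= /c => h; rewrite -h; field.
  exact: f0x.
exists (y + c *: x) => f; rewrite linearD linearZ/= -yP /GRing.scale /=; ring.
Qed.

End Bidual.

(** * A sequence without weak* convergent convex blocks *)

(** Rational coefficients make the combinations countable, so that a recursion can treat all of them
    through [pickle]. *)
Definition rational_comb {R : realType} {V : lmodType R} (q : seq rat)
    (v : nat -> V) : V := \sum_(i < size q) ratr q`_i *: v i.

Section Nonreflexive.
Context {R : realType} {X : completeNormedModType R}.

(** [Phi] has distance more than [t] from the image of [X]. If no such [f] existed for [s], then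
    [Phi] would be bounded by [t] on the annihilator of [s]; extending this restriction to [L] with
    norm at most [t], [Phi - L] would be an evaluation within [t] of [Phi]. *)
Lemma nonreflexive_annihilating_functional : ~ reflexive_space X ->
  exists (Phi : dual (dual X)) (t : R), 0 < t /\
  forall s : seq X, exists f : dual X,
    [/\ `|f| <= 1, Phi f = t & forall x, x \in s -> f x = 0].
Proof.
move=> /existsNP[Phi nPhi].
have [t [t0 Phit]] : exists t : R, 0 < t /\ forall x, t < `|Phi - evaluation x|.
  apply: contrapT => nt; apply: nPhi; apply: bidual_distance => e e0.
  apply: contrapT => ne; apply: nt; exists (e / 2).
  split=> [|x]; first by rewrite divr_gt0.
  rewrite ltNge; apply/negP => h; apply: ne; exists x.
  by rewrite (le_lt_trans h)// ltr_pdivrMr// ltr_pMr// ltr1n.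
exists Phi, t; split=> // s; apply: contrapT => nf.
have Phi_le (f : dual X) : (forall x, x \in s -> f x = 0) -> Phi f <= t * `|f|.
  move=> fs; rewrite leNgt; apply/negP => tf; apply: nf.
  have Pf0 : 0 < Phi f by rewrite (le_lt_trans _ tf)// mulr_ge0// ltW.
  exists ((t / Phi f) *: f); split.
  - rewrite normrZ ger0_norm; last by rewrite divr_ge0 ?ltW.
    by rewrite mulrAC ler_pdivrMr// mul1r ltW.
  - have -> : Phi ((t / Phi f) *: f) = t / Phi f * Phi f by rewrite linearZ.
    by rewrite divfK// gt_eqF.
  - by move=> x xs; have := fs x xs; rewrite dualZ => ->; rewrite mulr0.
have [||L [Lt LPhi]] := @dual_extension R (dual X)
    (fun f a => (forall x, x \in s -> f x = 0) /\ a = Phi f) t.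
- exact: ltW.
- split.
  + by split=> //; rewrite linear0.
  + move=> c f g _ _ [fs ->] [gs ->]; split; last by rewrite linearP.
    by move=> x xs; rewrite dualD dualZ fs// gs// mulr0 addr0.
  + by move=> f _ [fs ->]; exact: Phi_le.
have [||y yP] := @finite_annihilator R X (Phi - L) s.
- exact: dual_linear.
- by move=> f fs; rewrite dualD dualN (LPhi f (Phi f))// subrr.
have := Phit y; rewrite ltNge => /negP; apply; apply: le_trans Lt.
suff -> : Phi - evaluation y = L by [].
have -> : evaluation y = Phi - L.
  apply/val_inj/funext => f.
  by rewrite -[LHS]/(evaluation y f) evaluationE -yP.
by rewrite opprB addrC subrK.
Qed.

(* Each new functional is chosen to vanish on vectors norming the rational
   combinations of the previous ones. *)
Lemma nonreflexive_sequence : ~ reflexive_space X ->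
  exists (f : nat -> dual X) (Phi : dual (dual X)) (t : R),
  [/\ forall n, `|f n| <= 1, 0 < t, forall n, Phi (f n) = t &
      forall q : seq rat, exists x, [/\ `|x| <= 1,
        `|rational_comb q f| / 2 <= rational_comb q f x &
        \forall n \near \oo, f n x = 0]].
Proof.
move=> /nonreflexive_annihilating_functional[Phi [t [t0 PhiP]]].
have [norming normingP] := choice (@norming_vector R X).
(* Each code below [size l] is applied to the entries of [l], missing ones read as 0, so a long
   combination is treated in full only once [l] is long enough. *)
pose combs (l : seq (dual X)) := [seq norming (rational_comb
  (odflt [::] (unpickle m)) (fun i => l`_i)) | m <- iota 0 (size l)].
have [next nextP] := choice (fun l : seq (dual X) => PhiP (combs l)).
pose L := fix L n := if n is m.+1 then rcons (L m) (next (L m)) else [::].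
pose f n := next (L n).
have LE n : L n = mkseq f n by elim: n => //= n IH; rewrite mkseqS -IH.
exists f, Phi, t; split=> //.
- by move=> n; have [] := nextP (L n).
- by move=> n; have [] := nextP (L n).
move=> q; exists (norming (rational_comb q f)).
have [h1 h2] := normingP (rational_comb q f); split=> //.
(* From here on the code of [q] is among those treated and [L n] contains every functional that [q]
   involves. *)
exists (maxn (pickle q).+1 (size q)) => // n /=; rewrite geq_max => /andP[qn sn].
have [_ _] := nextP (L n); apply; apply/mapP; exists (pickle q).
  by rewrite mem_iota LE size_mkseq.
rewrite pickleK /=; congr norming; apply: eq_bigr => i _.
by rewrite LE nth_mkseq// (leq_trans (ltn_ord i)).
Qed.

End Nonreflexive.

(** * Convex blocks as finitely supported means *)

Section Means.
Context {R : realType}.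
Implicit Types (m : (nat -> R) -> R) (mu nu : nat -> (nat -> R) -> R).

(** Blocks are functionals on real sequences, so that the same block applies to [f n x], to a sign
    sequence and to their product. *)
Inductive hull (S : set ((nat -> R) -> R)) : ((nat -> R) -> R) -> Prop :=
| hull_in m : S m -> hull S m
| hull_conv t m1 m2 : 0 <= t <= 1 -> hull S m1 -> hull S m2 ->
    hull S (fun phi => t * m1 phi + (1 - t) * m2 phi).

Definition tail mu (k : nat) := [set mu i | i in [set i | (k <= i)%N]].

(* [nu] is a sequence of convex blocks of [mu], up to finitely many terms. *)
Definition refines nu mu := forall k, \forall j \near \oo, hull (tail mu k) (nu j).

Definition dirac_seq (n : nat) : (nat -> R) -> R := fun phi => phi n.

Lemma hull_sub S S' : S `<=` hull S' -> hull S `<=` hull S'.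
Proof. move=> SS' m; elim=> [m0 Sm0|t m1 m2 t01 _ h1 _ h2]; first exact: SS'.
exact: hull_conv. Qed.

Lemma hullS S S' : S `<=` S' -> hull S `<=` hull S'.
Proof. by move=> SS'; apply: hull_sub => m /SS'; exact: hull_in. Qed.

Lemma tailS mu k l : (k <= l)%N -> tail mu l `<=` tail mu k.
Proof. by move=> kl _ [i /= li <-]; exists i => //=; exact: leq_trans li. Qed.

Lemma refines_refl mu : refines mu mu.
Proof. by move=> k; exists k => // j /= kj; apply: hull_in; exists j. Qed.

Lemma refines_trans mu nu la : refines nu mu -> refines mu la -> refines nu la.
Proof.
move=> numu mula k; have [K _ Kmu] := mula k; have [J _ Jnu] := numu K.
exists J => // j /= Jj; apply: hull_sub (Jnu _ Jj) => _ [i /= Ki <-]; exact: Kmu.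
Qed.

(** The functionals whose value at [phi] is within [e] of [c] form a convex set. *)
Lemma hull_dist S m phi c e : hull S m ->
  (forall m', S m' -> `|c - m' phi| <= e) -> `|c - m phi| <= e.
Proof.
move=> Sm Se; elim: Sm => [m0 /Se//|t m1 m2 /andP[t0 t1] _ h1 _ h2].
have -> : c - (t * m1 phi + (1 - t) * m2 phi) =
  t * (c - m1 phi) + (1 - t) * (c - m2 phi) by ring.
rewrite (le_trans (ler_normD _ _))// !normrM ger0_norm//.
rewrite (@ger0_norm _ (1 - t)) ?subr_ge0//.
have -> : e = t * e + (1 - t) * e by ring.
by rewrite lerD// ler_wpM2l// subr_ge0.
Qed.

Lemma refines_cvg nu mu phi (c : R) : refines nu mu ->
  (fun j => mu j phi) @ \oo --> c -> (fun j => nu j phi) @ \oo --> c.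
Proof.
move=> numu /cvgrPdist_le mucvg; apply/cvgrPdist_le => e e0.
have [K _ Ke] := mucvg _ e0; have [J _ Je] := numu K.
exists J => // j /= Jj; apply: hull_dist (Je _ Jj) _ => _ [i /= Ki <-].
exact: Ke.
Qed.

(** The last clause is finite support starting at [k]; it allows blocks to be picked with successive
    disjoint supports. *)
Definition is_mean (k : nat) m : Prop :=
  [/\ forall t phi psi, m (fun n => t * phi n + psi n) = t * m phi + m psi,
      forall phi, (forall n, 0 <= phi n) -> 0 <= m phi,
      m (fun=> 1) = 1 &
      exists N, forall phi psi,
        (forall n, (k <= n < N)%N -> phi n = psi n) -> m phi = m psi].

Lemma hull_is_mean k m : hull (tail dirac_seq k) m -> is_mean k m.
Proof.
elim=> {m} [_ [n /= kn <-]|t m1 m2 /andP[t0 t1] _ [l1 p1 n1 [N1 h1]] _ [l2 p2 n2 [N2 h2]]].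
  split=> [|phi|//|]; [by move=> *|exact|].
  by exists n.+1 => phi psi; apply; rewrite kn /= ltnSn.
split.
- by move=> s phi psi; rewrite l1 l2; ring.
- by move=> phi phi0; rewrite addr_ge0// mulr_ge0 ?subr_ge0// ?p1 ?p2.
- by rewrite n1 n2; ring.
- exists (maxn N1 N2) => phi psi h.
  rewrite (h1 _ psi) ?(h2 phi psi)// => n /andP[kn nN]; apply: h; rewrite kn/=.
    by rewrite (leq_trans nN)// leq_maxr.
  by rewrite (leq_trans nN)// leq_maxl.
Qed.

(** [g] is the combination of the [f n] with the weights of [m]. Arbitrary linear [Phi] cover both
    evaluations at points of [X] and elements of the bidual. *)
Lemma hull_pairing {X : normedModType R} (f : nat -> dual X) m :
  hull (tail dirac_seq 0) m ->
  exists g : dual X, forall Phi : dual X -> R^o, linear Phi ->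
    Phi g = m (fun n => Phi (f n)).
Proof.
elim=> {m} [_ [n _ <-]|t m1 m2 t01 _ [g1 h1] _ [g2 h2]]; first by exists (f n).
exists (t *: g1 + (1 - t) *: g2) => Phi Pl.
have P0 : Phi 0 = 0.
  have := Pl 1 0 0; rewrite !scale1r addr0 => /eqP.
  by rewrite -subr_eq0 opprD addrA subrr sub0r oppr_eq0 => /eqP.
rewrite Pl -[(1 - t) *: g2]addr0 Pl P0 addr0 -h1// -h2//.
Qed.

End Means.

Lemma rational_approx {R : realType} (t e : R) : 0 < e ->
  exists r : rat, `|t - ratr r| < e.
Proof.
move=> e0.
have /rat_in_itvoo[r] : t - e < t + e by lra.
rewrite in_itv /= => /andP[r1 r2]; exists r.
by rewrite ltr_norml; lra.
Qed.

Section RationalComb.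
Context {R : realType} {V : normedModType R} (v : nat -> V).

Lemma rational_comb_widen q M : (size q <= M)%N ->
  rational_comb q v = \sum_(i < M) ratr q`_i *: v i :> V.
Proof.
move=> qM; rewrite /rational_comb (big_ord_widen M (fun i => ratr q`_i *: v i) qM).
rewrite big_mkcond; apply: eq_bigr => i _; case: ltnP => // qi.
by rewrite nth_default// raddf0 scale0r.
Qed.

(** This is the closed linear span of [v]. *)
Definition rational_closure : set V :=
  [set u | forall e : R, 0 < e -> exists q, `|u - rational_comb q v| < e].

Lemma rational_closure_mem n : rational_closure (v n).
Proof.
move=> e e0; exists (rcons (nseq n 0) 1).
suff -> : rational_comb (rcons (nseq n 0) 1) v = v n by rewrite subrr normr0.
rewrite (@rational_comb_widen _ n.+1) ?size_rcons ?size_nseq// big_ord_recr/=.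
rewrite nth_rcons size_nseq ltnn eqxx rmorph1 scale1r big1 ?add0r// => i _.
by rewrite nth_rcons size_nseq ltn_ord nth_nseq ltn_ord raddf0 scale0r.
Qed.

Lemma rational_closureP t u w :
  rational_closure u -> rational_closure w -> rational_closure (t *: u + w).
Proof.
move=> Gu Gw e e0.
have e3 : 0 < e / 3 by rewrite divr_gt0.
have u1 : 0 < `|u| + 1 by rewrite ltr_wpDl.
(* First [r] is chosen with a tolerance depending on [u], then [q1] with one depending on [r]; the
   added 1 keeps the denominators positive. *)
have [r tr] := rational_approx t (divr_gt0 e3 u1).
have r1 : 0 < `|ratr r : R| + 1 by rewrite ltr_wpDl.
have [q1 q1u] := Gu _ (divr_gt0 e3 r1).
have [q2 q2w] := Gw _ e3.
pose M := maxn (size q1) (size q2).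
exists (mkseq (fun i => r * q1`_i + q2`_i) M).
have -> : rational_comb (mkseq (fun i => r * q1`_i + q2`_i) M) v =
    ratr r *: rational_comb q1 v + rational_comb q2 v.
  rewrite (@rational_comb_widen _ M) ?size_mkseq//.
  rewrite (@rational_comb_widen q1 M) ?leq_maxl//.
  rewrite (@rational_comb_widen q2 M) ?leq_maxr//.
  rewrite scaler_sumr -big_split/=; apply: eq_bigr => i _.
  by rewrite nth_mkseq// rmorphD rmorphM scalerDl scalerA.
set c1 := rational_comb q1 v in q1u *; set c2 := rational_comb q2 v in q2w *.
move: (ratr r : R) tr r1 q1u => s tr s1 q1u.
have -> : t *: u + w - (s *: c1 + c2) =
    (t - s) *: u + s *: (u - c1) + (w - c2).
  rewrite scalerBl scalerBr opprD [LHS]addrACA; congr (_ + _).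
  by rewrite addrA subrK.
rewrite (le_lt_trans (ler_normD _ _))//.
have -> : e = e / 3 + e / 3 + e / 3 by field.
apply: ltrD => //; rewrite (le_lt_trans (ler_normD _ _))// !normrZ.
apply: ltrD.
  rewrite (@le_lt_trans _ _ (`|t - s| * (`|u| + 1)))//.
    by rewrite ler_wpM2l// lerDl.
  by rewrite -ltr_pdivlMr.
rewrite (@le_lt_trans _ _ ((`|s| + 1) * `|u - c1|))//.
  by apply: ler_wpM2r => //; rewrite lerDl.
by rewrite mulrC -ltr_pdivlMr.
Qed.

End RationalComb.

(** For bounded [f] this excludes weak* convergent block sequences, since pointwise limits of
    uniformly bounded functionals are again bounded functionals. *)
Definition convex_divergent {R : realType} {X : normedModType R}
    (f : nat -> dual X) : Prop :=
  forall mu : nat -> (nat -> R) -> R, refines mu dirac_seq ->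
    exists x, ~ cvg ((fun j => mu j (fun n => f n x)) @ \oo).

Section NonConvergence.
Context {R : realType} {X : completeNormedModType R}.

Lemma grothendieck_convex_divergent :
  ~ reflexive_space X -> grothendieck_space X ->
  exists f : nat -> dual X, (forall n, `|f n| <= 1) /\ convex_divergent f.
Proof.
move=> /nonreflexive_sequence[f [Phi [t [f1 t0 Phif fnorm]]]] Xgr.
exists f; split=> // mu mud; apply: contrapT => /forallNP ncvg.
have {}ncvg x : cvg ((fun j => mu j (fun n => f n x)) @ \oo).
  by apply: contrapT; exact: ncvg.
have [J _ Jmu] := mud 0%N.
(* [g j] is the functional given by the block [mu j]. Refinement only constrains late terms, so 0 is
   put before [J]. *)
have /choice[g gP] : forall j, exists g : dual X, (J <= j)%N ->
    forall Psi : dual X -> R^o, linear Psi -> Psi g = mu j (fun n => Psi (f n)).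
  move=> j; have [Jj|_] := leqP J j; last by exists 0.
  by have [g gP] := hull_pairing f (Jmu _ Jj); exists g.
have gx j x : (J <= j)%N -> g j x = mu j (fun n => f n x).
  by move=> Jj; apply: (gP j Jj (fun h : dual X => h x)) => a u v.
have gcvg x : (fun j => g j x) @ \oo --> lim ((fun j => mu j (fun n => f n x)) @ \oo).
  apply: cvg_trans (ncvg x); apply: near_eq_cvg; exists J => // j /= Jj.
  by rewrite gx.
have [||l lE] := @bounded_functional R X
  (fun x => lim ((fun j => mu j (fun n => f n x)) @ \oo)) 1.
- move=> a x y; apply: (cvg_unique _ (gcvg (a *: x + y))) => //.
  rewrite (_ : (fun j => g j (a *: x + y)) = (fun j => a * g j x + g j y)).
    by apply: cvgD; [apply: cvgMr; exact: gcvg|exact: gcvg].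
  by apply/funext => j; rewrite linearP.
- move=> x; rewrite mul1r.
  apply: (ler_cvg_to (f := fun j => `|g j x|) (g := fun=> `|x|) (a := \oo)).
  + by apply: cvg_norm; exact: gcvg.
  + exact: cvg_cst.
  + exists J => // j /= Jj; rewrite gx//.
    have := hull_dist (c := 0) (e := `|x|) (phi := fun n => f n x) (Jmu _ Jj).
    rewrite sub0r normrN; apply => _ [n _ <-]; rewrite sub0r normrN.
    by rewrite (le_trans (dual_le _ _))// -[leRHS]mul1r ler_wpM2r.
have wsl : weak_star_cvg g l by move=> x; rewrite lE; exact: gcvg.
have wl := (Xgr g l).1 wsl.
(* By weak convergence a constant value of [Psi] on the [f n] is its value at [l]. With [Phi] this
   gives [l != 0]; with a separating functional it puts [l] in the closed span. *)
have lPsi (Psi : dual (dual X)) c : (forall n, Psi (f n) = c) -> Psi l = c.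
  move=> Psif; apply: (cvg_unique _ (wl Psi)) => //.
  apply: cvg_near_cst; exists J => // j /= Jj.
  rewrite (gP j Jj Psi (dual_linear Psi)); under eq_fun do rewrite Psif.
  have [ml _ m1 _] := hull_is_mean (Jmu _ Jj).
  have := ml (c - 1) (fun=> 1) (fun=> 1); rewrite m1 mulr1 subrK => h; rewrite -[RHS]h.
  by congr (mu j _); apply/funext => n; rewrite mulr1 subrK.
have l0 : 0 < `|l|.
  rewrite normr_gt0; apply/eqP => l0.
  by have := lPsi Phi t Phif; rewrite l0 linear0; move/eqP; rewrite lt_eqF.
have lG : rational_closure f l.
  apply: contrapT => /existsNP[e /not_implyP[e0 /forallNP le]].
  have [||||Psi [Psi0 Psi1]] := @separating_functional R _ (rational_closure f) l (e / 2).
  - by move=> d d0; exists [::]; rewrite /rational_comb big_ord0 subrr normr0.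
  - by move=> a u v; exact: rational_closureP.
  - by rewrite divr_gt0.
  - move=> u /(_ (e / 2))[|q uq]; first by rewrite divr_gt0.
    have /negP := le q; rewrite -leNgt => lq.
    have := ler_distD u l (rational_comb q f); lra.
  have := lPsi Psi 0 (fun n => Psi0 _ (rational_closure_mem f n)).
  by rewrite Psi1 => /eqP; rewrite oner_eq0.
(* The combination [c] given by [q] has norm at least [7/8 |l|], so [c x >= 7/16 |l|]; but [l x = 0]
   forces [|c x| < |l| / 8]. *)
have [q ql] := lG (`|l| / 8) ltac:(by rewrite divr_gt0).
have [x [x1 qx fx]] := fnorm q.
have lx : l x = 0.
  rewrite lE; apply/cvg_lim => //; apply: (refines_cvg mud).
  exact: cvg_near_cst.
have := dual_le (rational_comb q f - l) x.
rewrite dualD dualN lx subr0 distrC => h.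
have := ler_norm (rational_comb q f x).
have := lerB_dist l (rational_comb q f).
have : `|l - rational_comb q f| * `|x| <= `|l - rational_comb q f|.
  by rewrite -[leRHS]mulr1 ler_wpM2l.
lra.
Qed.

End NonConvergence.

(** * Ultrafilter limits and small density *)

Section UltraLimit.
Context {R : realType} {T : Type} (F : set_system T) {FU : UltraFilter F}.

(** Compactness of the segment gives a cluster point, and an ultrafilter converges to its cluster
    points. *)
Lemma ultra_cvg (u : T -> R) (C : R) : F [set t | `|u t| <= C] -> cvg (u @ F).
Proof.
move=> uC; have uF : (u @ F) [set` `[- C, C]].
  suff : F [set t | u t \in `[- C, C]] by [].
  by apply: filterS uC => t /=; rewrite in_itv /= -ler_norml.
have [p [_ pu]] := @segment_compact R (- C) C (u @ F) _ uF.
apply/cvg_ex; exists p; apply/cvgrPdist_lt => e e0.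
have [//|nFe] := in_ultra_setVsetC [set t | `|p - u t| < e] FU.
have [y [/= ny py]] := pu (~` [set y | `|p - y| < e]) _ nFe (nbhsx_ballx p e e0).
by rewrite -ball_normE in py.
Qed.

End UltraLimit.

Lemma finite_set_natP (A : set nat) :
  finite_set A <-> exists N, forall n, A n -> (n < N)%N.
Proof.
split=> [/finite_seqP[s ->]|[N AN]]; last first.
  by apply: sub_finite_set (finite_II N) => n /AN.
exists (\max_(i <- s) i).+1 => n /= ns; rewrite ltnS.
exact: (leq_bigmax_seq (P := xpredT) (F := id)).
Qed.

Lemma infinite_set_natP (A : set nat) :
  infinite_set A <-> forall N, exists n, A n /\ (N <= n)%N.
Proof.
split=> [iA N|h /finite_set_natP[N AN]].
  apply: contrapT => nA; apply: iA; apply/finite_set_natP; exists N => n An.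
  by rewrite ltnNge; apply/negP => Nn; apply: nA; exists n.
by have [n [/AN]] := h N; rewrite ltnNge => /negP.
Qed.

Section SmallDensity.
Context {R : realType}.

(** The inequality p >= c, where having fewer than continuum many members is expressed by the reals
    not embedding. *)
Definition p_at_least_c :=
  forall F : set (set nat), strong_fip F -> ~ ([set: R] #<= F)%card ->
    exists A, pseudointersection F A.

Lemma free_ultrafilter : exists U : set_system nat, UltraFilter U /\ \oo `<=` U.
Proof. exact: ultraFilterLemma. Qed.

Lemma ultrafilter_strong_fip (U : set_system nat) (F : set (set nat)) :
  UltraFilter U -> \oo `<=` U -> F `<=` U -> strong_fip F.
Proof.
move=> UU ooU FU G GF Gfin Cfin.
have UG : U (\bigcap_(A in G) A).
  have /finite_fsetP[K GK] := Gfin.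
  by rewrite GK; apply: filter_bigI => A AK; apply/FU/GF; rewrite GK.
have /finite_set_natP[N CN] := Cfin.
have UN : U [set n | (N <= n)%N] by apply: ooU; exists N.
have [n [/= /CN]] := filter_ex (filterI UG UN).
by rewrite ltnNge => /negP.
Qed.

Lemma convex_divergent_density {X : normedModType R} (f : nat -> dual X)
    (D : set X) : p_at_least_c -> (forall n, `|f n| <= 1) -> convex_divergent f ->
  dense D -> ([set: R] #<= D `*` [set: nat])%card.
Proof.
move=> pc f1 fdiv Dd; apply: contrapT => RD.
have [U [UU ooU]] := free_ultrafilter.
have fx n x : `|f n x| <= `|x|.
  by rewrite (le_trans (dual_le _ _))// -[leRHS]mul1r ler_wpM2r.
pose l x := lim ((fun n => f n x) @ U).
have lP x : (fun n => f n x) @ U --> l x.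
  by apply: (ultra_cvg (C := `|x|)); apply: filterE => n; exact: fx.
pose fam (xk : X * nat) := [set n | `|l xk.1 - f n xk.1| < xk.2.+1%:R^-1].
have [||A [Ainf AF]] := pc (fam @` (D `*` [set: nat])).
- apply: (ultrafilter_strong_fip UU ooU) => _ [[x k] _ <-].
  by have /cvgrPdist_lt := lP x; apply; rewrite invr_gt0.
- by move=> /card_le_trans h; apply: RD; apply: h; exact: card_image_le.
have /choice[a aP] := (infinite_set_natP A).1 Ainf.
have aref : refines (fun j => dirac_seq (a j)) (@dirac_seq R).
  move=> k; exists k => // j /= kj; apply: hull_in; exists (a j) => //=.
  by rewrite (leq_trans kj)//; have [] := aP j.
have [x] := fdiv _ aref; apply.
(* The values converge to [l d] for [d] in [D]; for [d] close to [x], [l d] serves as centre in the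
   Cauchy criterion at [x]. *)
apply/cauchy_cvgP; apply: cauchy_exP => e e0.
have e4 : 0 < e / 4 by rewrite divr_gt0.
have [d [xd Dx]] : ball x (e / 4) `&` D !=set0.
  by apply: Dd; [exists x; exact: ballxx|exact: ball_open].
have [k ke] := small_inverse e4.
have /finite_set_natP[N NP] : finite_set (A `\` fam (d, k)).
  by apply: AF; exists (d, k).
exists (l d), N => // j /= Nj; rewrite -ball_normE /=.
have [Aj ja] := aP j.
have /= fj : fam (d, k) (a j).
  apply: contrapT => nf; have := NP (a j) (conj Aj nf).
  by rewrite ltnNge (leq_trans Nj).
rewrite (le_lt_trans (ler_distD (f (a j) d) _ _))//.
have fd : `|f (a j) d - f (a j) x| < e / 4.
  rewrite -linearB (le_lt_trans (fx _ _))//.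
  by rewrite -ball_normE /= distrC in xd.
have {}fj := lt_trans fj ke.
rewrite (lt_trans (ltrD fj fd))//; lra.
Qed.

End SmallDensity.

(** * Splitting block sequences *)

(** Let [p] be a cluster point. As [v] does not converge to [p], infinitely many terms stay at
    distance at least [e] from it, and these have a cluster point [q]. *)
Lemma divergent_two_clusters {R : realType} (v : nat -> R) (C : R) :
  (\forall j \near \oo, `|v j| <= C) -> ~ cvg (v @ \oo) ->
  exists p q, p <> q /\ forall N (e : R), 0 < e ->
    (exists j, (N <= j)%N /\ `|p - v j| < e) /\
    (exists j, (N <= j)%N /\ `|q - v j| < e).
Proof.
move=> [N0 _ vC] vdiv.
have clus (B : set nat) : infinite_set B -> exists p, forall N (e : R), 0 < e ->
    exists j, [/\ (N <= j)%N, B j & `|p - v j| < e].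
  move=> /infinite_set_natP Binf.
  pose F := within B \oo.
  have FF : ProperFilter F.
    apply: Build_ProperFilter => -[N _ NB].
    have [n [Bn Nn]] := Binf N; exact: (NB n Nn Bn).
  have vF : (v @ F) [set` `[- C, C]].
    exists N0 => // n /= Nn Bn; rewrite in_itv /= -ler_norml; exact: vC.
  have [p [_ pcl]] := @segment_compact R (- C) C (v @ F) _ vF.
  exists p => N e e0.
  have vN : (v @ F) [set y | exists j, [/\ (N <= j)%N, B j & y = v j]].
    by exists N => // n /= Nn Bn; exists n.
  have [y [[j [Nj Bj ->]]]] := pcl _ _ vN (nbhsx_ballx p e e0).
  by rewrite -ball_normE /= => pv; exists j.
have [p pP] := clus setT infinite_nat.
have [e [e0 Binf]] : exists e : R, 0 < e /\ infinite_set [set j | e <= `|p - v j|].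
  apply: contrapT => ne; apply: vdiv; apply/cvg_ex; exists p.
  apply/cvgrPdist_lt => e e0.
  have : finite_set [set j | e <= `|p - v j|].
    by apply: contrapT => inf; apply: ne; exists e.
  move=> /finite_set_natP[N NP]; exists N => // j /= Nj.
  rewrite ltNge; apply/negP => /NP; rewrite ltnNge => /negP; exact.
have [q qP] := clus _ Binf.
exists p, q; split.
  move=> pq; have [j [_ /= ej]] := qP 0%N e e0.
  by rewrite -pq ltNge ej.
move=> N d d0; split.
  by have [j [Nj _ pv]] := pP N d d0; exists j.
by have [j [Nj _ qv]] := qP N d d0; exists j.
Qed.

Section Splitting.
Context {R : realType} {X : normedModType R} (f : nat -> dual X).
Hypothesis f1 : forall n, `|f n| <= 1.
Hypothesis fdiv : convex_divergent f.

Lemma fx_le n x : `|f n x| <= `|x|.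
Proof. by rewrite (le_trans (dual_le _ _))// -[leRHS]mul1r ler_wpM2r. Qed.

(** With [e = (rho, x)], the limit 0 of [rho] ensures that later pairs differ from [e], and the
    nonzero limit [c] makes the functional induced by [rho] nonzero at [x]. *)
Definition splits mu (e : (nat -> R) * X) : Prop :=
  [/\ forall n, `|e.1 n| <= 1,
      (fun j => mu j e.1) @ \oo --> (0 : R) &
      exists c : R, c != 0 /\ (fun j => mu j (fun n => e.1 n * f n e.2)) @ \oo --> c].

Definition orthogonal mu (e e' : (nat -> R) * X) : Prop :=
  (fun j : nat => mu j (fun n : nat => e.1 n * e'.1 n)) @ \oo --> (0 : R).

Definition orthogonal_system (E : set ((nat -> R) * X)) mu : Prop :=
  [/\ refines mu dirac_seq, forall e, E e -> splits mu e &
      forall e e', E e -> E e' -> e <> e' -> orthogonal mu e e'].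

Lemma splits_refines mu nu e : refines nu mu -> splits mu e -> splits nu e.
Proof.
move=> numu [e1 e0 [c [c0 ec]]]; split=> //; first exact: refines_cvg e0.
by exists c; split=> //; exact: refines_cvg ec.
Qed.

Lemma hull_bound k (m : (nat -> R) -> R) phi (C : R) : hull (tail dirac_seq k) m ->
  (forall n, `|phi n| <= C) -> `|m phi| <= C.
Proof.
move=> mk phiC; have := hull_dist (c := 0) (e := C) (phi := phi) mk.
by rewrite sub0r normrN; apply => _ [n _ <-]; rewrite sub0r normrN; exact: phiC.
Qed.

(** The averages [nu] send [rho * phi] to half the difference of the values of [phi] on the two
    families of blocks. This tends to 0 whenever [mu j phi] does, in particular for the earlier
    sequences, and to [(p - q) / 2] for [phi n = f n x]. *)
Lemma orthogonal_system_extend E mu : orthogonal_system E mu ->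
  exists e nu, [/\ ~ E e, refines nu mu & orthogonal_system (e |` E) nu].
Proof.
move=> [mud Emu Eort].
have [x xdiv] := fdiv mud.
have [J _ Jmu] := mud 0%N.
have [|p [q [pq pqP]]] := divergent_two_clusters (C := `|x|) _ xdiv.
  exists J => // j /= Jj; apply: (hull_bound (Jmu _ Jj)) => n; exact: fx_le.
pose v j := mu j (fun n => f n x).
pose local k N (m : (nat -> R) -> R) := is_mean 0 m /\ forall phi psi : nat -> R,
  (forall n, (k <= n < N)%N -> phi n = psi n) -> m phi = m psi.
have pick k i (l : R) : (forall N (e : R), 0 < e -> exists j, (N <= j)%N /\ `|l - v j| < e) ->
    exists j N, [/\ (i <= j)%N, (k <= N)%N, `|l - v j| < i.+1%:R^-1 & local k N (mu j)].
  move=> lP; have [K _ Kmu] := mud k.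
  have [j [Kj lj]] := lP (maxn K (maxn i J)) i.+1%:R^-1 ltac:(by rewrite invr_gt0).
  move: Kj; rewrite !geq_max => /and3P[Kj ij Jj].
  have [_ _ _ [N NP]] := hull_is_mean (Kmu _ Kj).
  exists j, (maxn k N); split=> //; first exact: leq_maxl.
  split; first exact: hull_is_mean (Jmu _ Jj).
  move=> phi psi h; apply: NP => n /andP[kn nN]; apply: h.
  by rewrite kn (leq_trans nN)// leq_maxr.
(* From position [k]: a block near [p] supported between [k] and [m], then one near [q] supported
   between [m] and [n]. Iterating from [n] gives [K]. *)
have /choice[s sP] : forall ki : nat * nat, exists abmn : (nat * nat) * (nat * nat),
    [/\ (ki.2 <= abmn.1.1)%N, (ki.2 <= abmn.1.2)%N,
        [/\ (ki.1 <= abmn.2.1)%N & (abmn.2.1 <= abmn.2.2)%N],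
        [/\ `|p - v abmn.1.1| < ki.2.+1%:R^-1 & `|q - v abmn.1.2| < ki.2.+1%:R^-1] &
        local ki.1 abmn.2.1 (mu abmn.1.1) /\ local abmn.2.1 abmn.2.2 (mu abmn.1.2)].
  move=> [k i] /=.
  have [a [m [ia km pa la]]] := pick k i p (fun N e e0 => (pqP N e e0).1).
  have [b [n [ib mn qb lb]]] := pick m i q (fun N e e0 => (pqP N e e0).2).
  by exists ((a, b), (m, n)).
pose K := fix K i := if i is i'.+1 then (s (K i', i')).2.2 else 0%N.
pose a i := (s (K i, i)).1.1; pose b i := (s (K i, i)).1.2; pose m i := (s (K i, i)).2.1.
have Km i : (K i <= m i)%N by have [_ _ []] := sP (K i, i).
have mK i : (m i <= K i.+1)%N by have [_ _ []] := sP (K i, i).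
have KS i j : (i <= j)%N -> (K i <= K j)%N.
  move=> /subnK <-; elim: (j - i)%N => [|n IH]; first exact: leqnn.
  exact: leq_trans IH (leq_trans (Km _) (mK _)).
have ia i : (i <= a i)%N by have [] := sP (K i, i).
have ib i : (i <= b i)%N by have [] := sP (K i, i).
(* The intervals [K i, m i[ and [m i, K i.+1[ support mu (a i) and mu (b i), so
   [rho] is 1 on the former and -1 on the latter. *)
pose rho n : R := if `[< exists i, (K i <= n < m i)%N >] then 1 else -1.
have rho_sq n : rho n * rho n = 1.
  by rewrite /rho; case: asboolP; rewrite ?mulr1// mulrNN mulr1.
have mu_a i phi : mu (a i) (fun n => rho n * phi n) = mu (a i) phi.
  have [_ _ _ _ [[_ h] _]] := sP (K i, i); apply: h => n Kn.
  by rewrite /rho asboolT ?mul1r//; exists i.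
have mu_b i phi : mu (b i) (fun n => rho n * phi n) = - mu (b i) phi.
  have [_ _ _ _ [_ [[ml _ _ _] h]]] := sP (K i, i).
  have ml0 : mu (b i) (fun=> 0) = 0.
    have := ml 1 (fun=> 0) (fun=> 0); rewrite mul1r mul1r addr0 => h0.
    by have := congr1 (fun z => z - mu (b i) (fun=> 0)) h0; rewrite addrK subrr.
  have := ml (-1) phi (fun=> 0); rewrite ml0 addr0 mulN1r => <-.
  apply: h => n /andP[mn nK]; rewrite /rho asboolF ?addr0// => -[i' /andP[Kn nm]].
  have [ii'|i'i|ii'] := ltngtP i i'.
  - by have := KS _ _ ii'; rewrite leqNgt (leq_ltn_trans Kn nK).
  - have := leq_trans (mK i') (KS _ _ i'i).
    by rewrite leqNgt (leq_ltn_trans (leq_trans (Km i) mn) nm).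
  - by move: nm; rewrite -ii' ltnNge mn.
pose nu i : (nat -> R) -> R := fun phi => 2^-1 * mu (a i) phi + (1 - 2^-1) * mu (b i) phi.
have nu_rho i phi : nu i (fun n => rho n * phi n) = 2^-1 * (mu (a i) phi - mu (b i) phi).
  by rewrite /nu mu_a mu_b; field.
have numu : refines nu mu.
  move=> k; exists k => // i /= ki; apply: hull_conv.
  - by rewrite invr_ge0 ler0n invf_le1// ler1n.
  - by apply: hull_in; exists (a i) => //=; exact: leq_trans ki (ia i).
  - by apply: hull_in; exists (b i) => //=; exact: leq_trans ki (ib i).
have nu_cvg phi (c d : R) : (fun i => mu (a i) phi) @ \oo --> c ->
    (fun i => mu (b i) phi) @ \oo --> d ->
    (fun i => nu i (fun n => rho n * phi n)) @ \oo --> 2^-1 * (c - d).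
  move=> ac bd; under eq_fun do rewrite nu_rho.
  by apply: cvgMr; exact: cvgB.
have amu : refines (mu \o a) mu.
  move=> k; exists k => // i /= ki; apply: hull_in; exists (a i) => //=.
  exact: leq_trans ki (ia i).
have bmu : refines (mu \o b) mu.
  move=> k; exists k => // i /= ki; apply: hull_in; exists (b i) => //=.
  exact: leq_trans ki (ib i).
have nu_ort phi : (fun j => mu j phi) @ \oo --> (0 : R) ->
    (fun i => nu i (fun n => rho n * phi n)) @ \oo --> (0 : R).
  move=> phi0; have := nu_cvg phi 0 0 (refines_cvg amu phi0) (refines_cvg bmu phi0).
  by rewrite subrr mulr0.
have nu1 i : nu i (fun=> 1) = 1.
  have [_ _ _ _ [[[_ _ h1 _] _] [[_ _ h2 _] _]]] := sP (K i, i).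
  by rewrite /nu [mu (a i) _]h1 [mu (b i) _]h2; ring.
have rho_nu : (fun j => nu j rho) @ \oo --> (0 : R).
  apply: cvg_near_cst; apply: nearW => i.
  have -> : rho = (fun n => rho n * 1) by apply/funext => n; rewrite mulr1.
  have [_ _ _ _ [[[_ _ h1 _] _] [[_ _ h2 _] _]]] := sP (K i, i).
  by rewrite nu_rho [mu (a i) _]h1 [mu (b i) _]h2 subrr mulr0.
have inv_cvg (u : nat -> nat) (l : R) :
    (forall i, `|l - v (u i)| < i.+1%:R^-1) -> (fun i => v (u i)) @ \oo --> l.
  move=> ul; apply/cvgrPdist_lt => e e0; have [N Ne] := small_inverse e0.
  exists N => // i /= Ni; rewrite (lt_trans (ul i))// (le_lt_trans _ Ne)//.
  by rewrite lef_pV2 ?posrE// ler_nat.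
exists (rho, x), nu; split=> //.
  (* If the pair were already in [E], the limit of [nu j (rho * rho)] would be 0, yet it is 1
     because [rho] takes the values 1 and -1. *)
  move=> /Emu[_ /= rho0 _]; have := nu_ort _ rho0.
  under eq_fun do under eq_fun do rewrite rho_sq.
  under eq_fun do rewrite nu1.
  move=> h; have h10 := cvg_unique (@Rhausdorff R) (cvg_cst _) h.
  by have := oner_neq0 R; rewrite h10 eqxx.
split; first exact: refines_trans numu mud.
  move=> e [->|/Emu]; last exact: splits_refines.
  split=> //=.
    by move=> n; rewrite /rho; case: asboolP; rewrite ?normrN normr1.
  exists (2^-1 * (p - q)); split.
    by rewrite mulf_neq0 ?invr_eq0 ?pnatr_eq0// subr_eq0; apply/eqP.
  apply: nu_cvg; apply: inv_cvg => i.
    by have [_ _ _ []] := sP (K i, i).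
  by have [_ _ _ []] := sP (K i, i).
move=> e e' [->|Ee] [->|Ee'] // ee'.
- by apply: nu_ort; have [] := Emu _ Ee'.
- rewrite /orthogonal; under eq_fun do under eq_fun do rewrite mulrC.
  by apply: nu_ort; have [] := Emu _ Ee.
- by apply: refines_cvg numu _; exact: Eort.
Qed.

End Splitting.

(** * Chains of splittings and their limit mean *)

Section Chains.
Context {R : realType} {X : normedModType R} (f : nat -> dual X).
Hypothesis f1 : forall n, `|f n| <= 1.
Hypothesis fdiv : convex_divergent f.

Let elt : Type := ((nat -> R) * X)%type.

Record stage := Stage {
  stage_set : set elt;
  stage_seq : nat -> (nat -> R) -> R;
  stageP : orthogonal_system f stage_set stage_seq }.

(* By the last clause a chain strictly increases the sets of its stages, so it
   has a countable cofinal part as soon as their union is countable. *)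
Definition stage_le (s t : stage) : bool :=
  `[< [/\ stage_set s `<=` stage_set t, refines (stage_seq t) (stage_seq s) &
          (stage_set s = stage_set t -> s = t)] >].

Lemma stage_lexx s : stage_le s s.
Proof. by apply/asboolP; split => //; exact: refines_refl. Qed.

Lemma stage_le_trans : forall r s t, stage_le r s -> stage_le s t -> stage_le r t.
Proof.
move=> r s t /asboolP[rs rrs ers] /asboolP[st rst est]; apply/asboolP; split.
- exact: subset_trans rs st.
- exact: refines_trans rst rrs.
- move=> rt; have rs' : stage_set r = stage_set s.
    by apply/seteqP; split => //; rewrite rt.
  by rewrite (ers rs'); apply: est; rewrite -rs'.
Qed.

Lemma stage_le_anti s t : stage_le s t -> stage_le t s -> s = t.
Proof.
move=> /asboolP[st _ est] /asboolP[ts _ _]; apply: est.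
by apply/seteqP; split.
Qed.

Lemma stage_leS s t : stage_le s t -> stage_set s `<=` stage_set t.
Proof. by move=> /asboolP[]. Qed.

Lemma stage_le_refines s t : stage_le s t -> refines (stage_seq t) (stage_seq s).
Proof. by move=> /asboolP[]. Qed.

Definition chain_set (A : set stage) := \bigcup_(s in A) stage_set s.

Lemma stage_no_max t : exists t', stage_le t t' /\ t <> t'.
Proof.
have [e [nu [Ee tnu os]]] := orthogonal_system_extend f1 fdiv (stageP t).
exists (Stage os); split.
  apply/asboolP; split=> /=; [by move=> x; right|exact: tnu|move=> E].
  by case: Ee; rewrite E; left.
by move=> E; case: Ee; rewrite E; left.
Qed.

(** The term number [j] comes from the sequence of [d j], so far out that it is a block of the tail
    from [j] of the sequence of each [d l] with [l <= j]. *)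
Lemma stage_diagonal (d : nat -> stage) :
  (forall i j, (i <= j)%N -> stage_le (d i) (d j)) ->
  exists nu, forall l, refines nu (stage_seq (d l)).
Proof.
move=> dmono.
have /choice[i iP] : forall j, exists i, forall l, (l <= j)%N ->
    hull (tail (stage_seq (d l)) j) (stage_seq (d j) i).
  move=> j.
  suff H m : (m <= j)%N -> \forall i \near \oo, forall l, (l <= m)%N ->
      hull (tail (stage_seq (d l)) j) (stage_seq (d j) i).
    by have [N _ NP] := H j (leqnn j); exists N; apply: NP => /=.
  elim: m => [|m IH] mj.
    have [N _ NP] := stage_le_refines (dmono _ _ mj) j.
    by exists N => // i Ni l; rewrite leqn0 => /eqP ->; exact: NP.
  have [N _ NP] := stage_le_refines (dmono _ _ mj) j.
  have [M _ MP] := IH (ltnW mj).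
  exists (maxn N M) => // i /=; rewrite geq_max => /andP[Ni Mi] l.
  by rewrite leq_eqVlt => /predU1P[->|]; [exact: NP|rewrite ltnS; exact: MP].
exists (fun j => stage_seq (d j) (i j)) => l k.
exists (maxn l k) => // j /=; rewrite geq_max => /andP[lj kj].
exact: hullS (tailS kj) _ (iP j l lj).
Qed.

Lemma countable_chain_bounded (A : set stage) (s0 : stage) :
  total_on A stage_le -> countable (chain_set A) ->
  exists t, forall s, A s -> stage_le s t.
Proof.
move=> Atot /countable_injP[g ginj].
have [//|nomax] := pselect (exists t, forall s, A s -> stage_le s t).
have [[s1 As1]|A0] := pselect (A !=set0); last first.
  by exists s0 => s As; case: A0; exists s.
(* A member containing the whole union would bound the chain, as equal sets force equal comparable
   stages. *)
have grow s : A s -> exists e, [/\ chain_set A e & ~ stage_set s e].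
  move=> As; apply: contrapT => ne; apply: nomax; exists s => t At.
  have [//|st] := Atot _ _ At As.
  suff -> : t = s by exact: stage_lexx.
  have /asboolP[sst _ est] := st; apply/esym/est; apply/seteqP; split=> // e te.
  by apply: contrapT => nse; apply: ne; exists e; split=> //; exists t.
have /choice[c cP] : forall n, exists t, A t /\
    forall e, chain_set A e -> g e = n -> stage_set t e.
  move=> n; have [[e [[t At te] gen]]|ne] := pselect (exists e, chain_set A e /\ g e = n).
    exists t; split=> // e' Ue' ge'; rewrite (ginj e' e) ?inE ?ge'//.
    by exists t.
  by exists s1; split=> // e Ue ge; case: ne; exists e.
(* [c n] contains the element of the union numbered [n], if any; [d] is the running maximum of [c],
   hence an increasing sequence exhausting the union. *)
pose d := fix d n := if n is m.+1 then
  (if stage_le (d m) (c n) then c n else d m) else c 0%N.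
have dA n : A (d n).
  elim: n => [|n IH] /=; first by have [] := cP 0%N.
  by case: ifP => _ //; have [] := cP n.+1.
have cd n : stage_le (c n) (d n).
  case: n => [|n] /=; first exact: stage_lexx.
  case: ifPn => [_|nle]; first exact: stage_lexx.
  by have [] := Atot _ _ (dA n) (cP n.+1).1; rewrite ?(negbTE nle).
have dmono i j : (i <= j)%N -> stage_le (d i) (d j).
  move=> /subnK <-; elim: (j - i)%N => [|n IH]; first exact: stage_lexx.
  by apply: stage_le_trans IH _ => /=; case: ifPn => // _; exact: stage_lexx.
have [nu nuP] := stage_diagonal dmono.
have Ud e : chain_set A e -> stage_set (d (g e)) e.
  by move=> Ue; apply: stage_leS (cd _) _ _; have [_] := cP (g e); exact.
have os : orthogonal_system f (chain_set A) nu.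
  split.
  - apply: refines_trans (nuP 0%N) _; by have [] := stageP (d 0%N).
  - move=> e Ue; apply: splits_refines (nuP (g e)) _.
    by have [_ + _] := stageP (d (g e)); apply; exact: Ud.
  - move=> e e' Ue Ue' ee'; apply: refines_cvg (nuP (maxn (g e) (g e'))) _.
    have [_ _] := stageP (d (maxn (g e) (g e'))); apply=> //.
      by apply: stage_leS (dmono _ _ (leq_maxl _ _)) _ _; exact: Ud.
    by apply: stage_leS (dmono _ _ (leq_maxr _ _)) _ _; exact: Ud.
exists (Stage os) => s As.
have [e [Ue se]] := grow s As.
have sd : stage_le s (d (g e)).
  have [//|ds] := Atot _ _ As (dA (g e)).
  by case: se; apply: stage_leS ds _ _; exact: Ud.
apply/asboolP; split=> /=.
- by move=> x sx; exists s.
- exact: refines_trans (nuP _) (stage_le_refines sd).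
- by move=> sU; case: se; rewrite sU.
Qed.

(** Otherwise every chain would be bounded and Zorn's lemma would give a maximal stage, which can
    still be extended. *)
Lemma uncountable_chain : exists A : set stage,
  total_on A stage_le /\ ~ countable (chain_set A).
Proof.
have os0 : orthogonal_system f set0 dirac_seq.
  by split=> //; exact: refines_refl.
apply: contrapT => /forallNP nA.
have [||||t tmax] := @Zorn stage stage_le.
- exact: stage_lexx.
- exact: stage_le_trans.
- exact: stage_le_anti.
- move=> A Atot; apply: (countable_chain_bounded (Stage os0) Atot).
  by apply: contrapT => cA; apply: (nA A).
have [t' [tt' ne]] := stage_no_max t.
by apply: ne; rewrite (tmax _ tt').
Qed.

Definition bounded_seq (phi : nat -> R) := exists C : R, forall n, `|phi n| <= C.

(** The inner limit runs along one block sequence, the outer one along an ultrafilter containing the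
    final segments of the chain. A limit reached at stage [s] persists at later stages by
    refinement, so [M] returns it. *)
Lemma chain_mean (A : set stage) : total_on A stage_le -> A !=set0 ->
  exists M : (nat -> R) -> R,
  [/\ forall t phi psi, bounded_seq phi -> bounded_seq psi ->
        M (fun n => t * phi n + psi n) = t * M phi + M psi,
      forall phi, bounded_seq phi -> (forall n, 0 <= phi n) -> 0 <= M phi &
      forall s phi (c : R), A s -> (fun j => stage_seq s j phi) @ \oo --> c ->
        M phi = c].
Proof.
move=> Atot [s0 As0].
pose F := filter_from A (fun s => [set t | A t /\ stage_le s t]).
have FF : ProperFilter F.
  apply: filter_from_proper; last by move=> s As; exists s; split=> //; exact: stage_lexx.
  apply: filter_from_filter; first by exists s0.
  move=> s t As At; have [st|ts] := Atot _ _ As At.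
    exists t => // r [Ar tr]; split; split => //; exact: stage_le_trans st tr.
  exists s => // r [Ar sr]; split; split => //; exact: stage_le_trans ts sr.
have [W [WU FW]] := ultraFilterLemma FF.
have [V [VU ooV]] := free_ultrafilter.
pose inner phi t : R := lim ((fun j => stage_seq t j phi) @ V).
have mean t : V [set j | is_mean 0 (stage_seq t j)].
  apply: ooV; have [td _ _] := stageP t; have [J _ Jt] := td 0%N.
  by exists J => // j /= /Jt /hull_is_mean.
have Vbound t phi (C : R) : (forall n, `|phi n| <= C) ->
    V [set j | `|stage_seq t j phi| <= C].
  move=> phiC; apply: ooV; have [td _ _] := stageP t; have [J _ Jt] := td 0%N.
  by exists J => // j /= /Jt /hull_bound; exact.
have innerP phi t : bounded_seq phi -> (fun j => stage_seq t j phi) @ V --> inner phi t.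
  by move=> [C phiC]; exact: ultra_cvg (Vbound t phi C phiC).
have inner_le phi t (C : R) : (forall n, `|phi n| <= C) -> `|inner phi t| <= C.
  move=> phiC; have bphi : bounded_seq phi by exists C.
  apply: (ler_cvg_to (f := fun j => `|stage_seq t j phi|) (g := fun=> C) (a := V)).
  - by apply: cvg_norm; exact: innerP.
  - exact: cvg_cst.
  - exact: Vbound.
pose M phi : R := lim (inner phi @ W).
have MP phi : bounded_seq phi -> inner phi @ W --> M phi.
  move=> [C phiC]; apply: (ultra_cvg (C := C)).
  by apply: filterE => t; exact: inner_le.
exists M; split.
- move=> t phi psi bphi bpsi.
  have inner_lin s : inner (fun n => t * phi n + psi n) s =
      t * inner phi s + inner psi s.
    apply/cvg_lim => //; apply: cvg_trans; last first.
      exact: (cvgD (cvgMr (innerP phi s bphi)) (innerP psi s bpsi)).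
    apply: near_eq_cvg; apply: filterS (mean s) => j /= [ml _ _ _].
    by rewrite ml.
  rewrite /M (_ : inner _ = fun s => t * inner phi s + inner psi s).
    by apply/cvg_lim => //; exact: (cvgD (cvgMr (MP phi bphi)) (MP psi bpsi)).
  by apply/funext.
- move=> phi bphi phi0.
  apply: cvgr_to_ge (MP phi bphi) _; apply: filterE => s.
  apply: cvgr_to_ge (innerP phi s bphi) _.
  by apply: filterS (mean s) => j /= [_ m0 _ _]; exact: m0.
- move=> s phi c As sc; apply/cvg_lim => //; apply: cvg_near_cst.
  apply: FW; exists s => // t [At st] /=.
  rewrite /inner; apply/cvg_lim => //; apply: cvg_trans (refines_cvg (stage_le_refines st) sc).
  by apply: cvg_app; exact: ooV.
Qed.

End Chains.

(** * Bessel's inequality for a finitely additive mean *)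

Section Bessel.
Context {R : realType} {I : choiceType} (U : set I) (rho : I -> nat -> R).
Variable M : (nat -> R) -> R.
Hypothesis M_linear : forall t phi psi, bounded_seq phi -> bounded_seq psi ->
  M (fun n => t * phi n + psi n) = t * M phi + M psi.
Hypothesis M_ge0 : forall phi, bounded_seq phi -> (forall n, 0 <= phi n) -> 0 <= M phi.
Hypothesis M1 : M (fun=> 1) = 1.
Hypothesis rho1 : forall i, U i -> forall n, `|rho i n| <= 1.
Hypothesis rho_ort : forall i j, U i -> U j -> i <> j ->
  M (fun n => rho i n * rho j n) = 0.

Lemma bounded_seqM phi psi : bounded_seq phi -> bounded_seq psi ->
  bounded_seq (fun n => phi n * psi n : R).
Proof.
by move=> [C phiC] [D psiD]; exists (C * D) => n; rewrite normrM ler_pM.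
Qed.

Lemma bounded_seqD t phi psi : bounded_seq phi -> bounded_seq psi ->
  bounded_seq (fun n => t * phi n + psi n : R).
Proof.
move=> [C phiC] [D psiD]; exists (`|t| * C + D) => n.
by rewrite (le_trans (ler_normD _ _))// lerD// normrM ler_wpM2l.
Qed.

Lemma mean_le phi (C : R) : bounded_seq phi -> (forall n, phi n <= C) -> M phi <= C.
Proof.
move=> bphi phiC.
have b1 : bounded_seq (fun=> 1 : R) by exists 1 => n; rewrite normr1.
have bC : bounded_seq (fun=> C) by exists `|C|.
(* To fit the form [t * phi + psi], the constant is written as [(C - 1) * 1 + 1]. *)
have MC : M (fun=> C) = C.
  have := @M_linear (C - 1) _ _ b1 b1; rewrite M1 mulr1 subrK => h.
  by rewrite -[RHS]h; congr M; apply/funext => n; rewrite mulr1 subrK.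
have := M_ge0 (bounded_seqD (-1) bphi bC).
by rewrite M_linear// MC mulN1r addrC subr_ge0; apply => n; rewrite mulN1r addrC subr_ge0.
Qed.

Lemma mean_norm_le phi (C : R) : (forall n, `|phi n| <= C) -> `|M phi| <= C.
Proof.
move=> phiC; have bphi : bounded_seq phi by exists C.
have b1 : bounded_seq (fun=> 1 : R) by exists 1 => n; rewrite normr1.
have M0 : M (fun n => -1 * 1 + 1) = 0 by rewrite M_linear// M1 mulr1 addNr.
have b0 : bounded_seq (fun=> -1 * 1 + 1 : R) by exact: bounded_seqD.
rewrite ler_norml; apply/andP; split; last first.
  by apply: mean_le => // n; rewrite (le_trans (ler_norm _)).
have := @mean_le _ C (bounded_seqD (-1) bphi b0).
rewrite M_linear// M0 addr0 mulN1r lerNl. rewrite -[- M phi]mulN1r; apply => n.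
by rewrite mulN1r addNr addr0 (le_trans (ler_norm _))// normrN.
Qed.

Lemma bounded_rho i : U i -> bounded_seq (rho i).
Proof. by move=> Ui; exists 1; exact: rho1. Qed.

(** [G r] is [phi] minus its components along the [rho i] for [i] in [r]. Each subtraction lowers
    the mean square by at least [c i ^+ 2], as [rho i] has mean square at most 1. *)
Lemma bessel (phi : nat -> R) (s : seq I) : bounded_seq phi -> uniq s ->
  (forall i, i \in s -> U i) ->
  \sum_(i <- s) M (fun n => rho i n * phi n) ^+ 2 <= M (fun n => phi n * phi n).
Proof.
move=> bphi; pose c i := M (fun n => rho i n * phi n).
pose G := fix G s n := if s is i :: s' then - c i * rho i n + G s' n else phi n.
have bG r : (forall i, i \in r -> U i) -> bounded_seq (G r).
  elim: r => //= i r IH rU; apply: bounded_seqD.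
    by apply: bounded_rho; apply: rU; rewrite mem_head.
  by apply: IH => j jr; apply: rU; rewrite inE jr orbT.
have cG r j : (forall i, i \in r -> U i) -> U j -> j \notin r ->
    M (fun n => rho j n * G r n) = c j.
  move=> + Uj; elim: r => //= i r IH rU; rewrite inE negb_or => /andP[ji jr].
  have Ui : U i by apply: rU; rewrite mem_head.
  have rU' k : k \in r -> U k by move=> kr; apply: rU; rewrite inE kr orbT.
  have bj := bounded_rho Uj.
  rewrite (_ : (fun n => _) = (fun n => - c i * (rho j n * rho i n) + rho j n * G r n)).
    rewrite M_linear; [|by apply: bounded_seqM => //; exact: bounded_rho|
      by apply: bounded_seqM => //; exact: bG].
    by rewrite rho_ort ?mulr0 ?add0r ?IH//; exact/eqP.
  by apply/funext => n; rewrite mulrDr mulrCA.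
have main r : uniq r -> (forall i, i \in r -> U i) ->
    M (fun n => G r n * G r n) <= M (fun n => phi n * phi n) - \sum_(i <- r) c i ^+ 2.
  elim: r => [|i r IH] /=; first by rewrite big_nil subr0.
  move=> /andP[ir ur] rU.
  have Ui : U i by apply: rU; rewrite mem_head.
  have rU' k : k \in r -> U k by move=> kr; apply: rU; rewrite inE kr orbT.
  have bi := bounded_rho Ui; have bGr := bG _ rU'.
  rewrite (_ : (fun n => _) = (fun n => (- 2 * c i) * (rho i n * G r n) +
      (c i ^+ 2 * (rho i n * rho i n) + G r n * G r n))); last first.
    by apply/funext => n; ring.
  rewrite M_linear; [|exact: bounded_seqM|apply: bounded_seqD; exact: bounded_seqM].
  rewrite M_linear; [|exact: bounded_seqM|exact: bounded_seqM].
  rewrite cG// big_cons.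
  have : c i ^+ 2 * M (fun n => rho i n * rho i n) <= c i ^+ 2.
    rewrite -[leRHS]mulr1; apply: ler_wpM2l; first exact: sqr_ge0.
    apply: mean_le => [|n]; first exact: bounded_seqM.
    by rewrite (le_trans (ler_norm _))// normrM mulr_ile1// rho1.
  have := IH ur rU'; rewrite expr2; lra.
move=> us sU; rewrite -subr_ge0; apply: le_trans (main _ us sU).
apply: M_ge0 => [|n]; last by rewrite -expr2 sqr_ge0.
by apply: bounded_seqM; exact: bG.
Qed.

Lemma bessel_countable (phi : nat -> R) : bounded_seq phi ->
  countable [set i | U i /\ M (fun n => rho i n * phi n) != 0].
Proof.
move=> bphi; pose c i := M (fun n => rho i n * phi n).
pose A k := [set i | U i /\ k.+1%:R^-1 < c i ^+ 2].
have -> : [set i | U i /\ c i != 0] = \bigcup_(k in [set: nat]) A k.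
  apply/seteqP; split=> [i [Ui ci]|i [k _ [Ui ki]]].
    have [|k kc] := @small_inverse _ (c i ^+ 2).
      by rewrite lt_neqAle sqr_ge0 eq_sym sqrf_eq0 ci.
    by exists k.
  split=> //; apply/eqP => ci; move: ki; rewrite ci expr0n/= ltNge.
  by rewrite invr_ge0 ler0n.
apply: bigcup_countable => // k _; apply: finite_set_countable.
apply: contrapT => Ainf.
pose B := M (fun n => phi n * phi n).
(* [N] indices with square above [1 / (k + 1)] would make the sum exceed [B]. *)
have [N BN] : exists N : nat, B * k.+1%:R < N%:R.
  by exists (Num.bound `|B * k.+1%:R|); rewrite (le_lt_trans (ler_norm _))// archi_boundP.
have [D DA DN] := infinite_set_fset N Ainf.
have := @bessel phi (finmap.enum_fset D) bphi (finmap.fset_uniq D).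
have DA' i : i \in finmap.enum_fset D -> A k i by move=> iD; exact: DA.
move=> /(_ (fun i iD => (DA' i iD).1)); rewrite leNgt => /negP; apply.
rewrite -/B (@lt_le_trans _ _ (N%:R / k.+1%:R))//.
  by rewrite ltr_pdivlMr.
rewrite (@le_trans _ _ (\sum_(i <- finmap.enum_fset D) k.+1%:R^-1))//.
  rewrite big_const_seq count_predT iter_addr_0 -[leRHS]mulr_natl ler_wpM2r//.
  by rewrite ler_nat.
rewrite big_seq [leRHS]big_seq; apply: ler_sum => i iD.
by have [_ /ltW] := DA' i iD.
Qed.

End Bessel.

(** The index set is the union of an uncountable chain, and [r e] sends [y] to the mean of
    [rho n * f n y] for [e = (rho, x)]. The nonzero limit in [splits] gives [r e != 0]; Bessel's
    inequality for [f n x] gives countability. *)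
Theorem grothendieck_countable_support {R : realType} {X : completeNormedModType R} :
  ~ reflexive_space X -> grothendieck_space X ->
  exists (I : choiceType) (U : set I) (r : I -> dual X),
  [/\ ~ countable U, forall i, U i -> r i != 0 &
      forall x, countable [set i | U i /\ r i x != 0]].
Proof.
move=> nrefl Xgr.
have [f [f1 fdiv]] := grothendieck_convex_divergent nrefl Xgr.
have [A [Atot Aunc]] := uncountable_chain f1 fdiv.
have A0 : A !=set0.
  apply: contrapT => A0; apply: Aunc.
  suff -> : chain_set A = set0 by exact: countable0.
  by rewrite -subset0 => e [s As _]; apply: A0; exists s.
have [M [M_lin M_ge0 M_lim]] := chain_mean Atot A0.
pose U := chain_set A.
have bfx x : bounded_seq (fun n => f n x : R) by exists `|x| => n; exact: fx_le.
have M1 : M (fun=> 1) = 1.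
  have [s As] := A0; apply: (M_lim s) => //; apply: cvg_near_cst.
  have [sd _ _] := stageP s; have [J _ Jt] := sd 0%N.
  by exists J => // j /= /Jt /hull_is_mean[].
have Usplit e : U e -> exists s, A s /\ splits f (stage_seq s) e.
  by move=> [s As se]; exists s; split=> //; have [_ + _] := stageP s; apply.
have rho1 e : U e -> forall n, `|e.1 n| <= 1 by move=> /Usplit[s [_ []]].
have ort e e' : U e -> U e' -> e <> e' -> M (fun n => e.1 n * e'.1 n) = 0.
  move=> [s As se] [t At te'] ee'.
  have [st|ts] := Atot _ _ As At.
    apply: (M_lim t) => //; have [_ _] := stageP t; apply => //.
    exact: stage_leS st _ _.
  apply: (M_lim s) => //; have [_ _] := stageP s; apply => //.
  exact: stage_leS ts _ _.
have /choice[r rP] : forall e : (nat -> R) * X, exists g : dual X,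
    U e -> forall x, g x = M (fun n => e.1 n * f n x).
  move=> e; have [Ue|nUe] := pselect (U e); last by exists 0.
  have be : bounded_seq e.1 by exists 1; exact: rho1.
  have bef x : bounded_seq (fun n => e.1 n * f n x) by exact: bounded_seqM.
  have [||g gE] := @bounded_functional R X (fun x => M (fun n => e.1 n * f n x)) 1.
  - move=> t x y; rewrite -[RHS]M_lin//; congr M; apply/funext => n.
    by rewrite linearP mulrDr mulrCA.
  - move=> x; rewrite mul1r.
    have efx n : `|e.1 n * f n x| <= `|x|.
      rewrite normrM -[leRHS]mul1r ler_pM//; first exact: rho1.
      exact: fx_le.
    exact: (mean_norm_le M_lin M_ge0 M1 efx).
  by exists g => _ x; rewrite gE.
exists _, U, r; split=> //.
- move=> e Ue; have [s [As [_ _ [c [c0 ec]]]]] := Usplit e Ue.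
  apply/eqP => re; have := rP e Ue e.2.
  by rewrite (M_lim s _ c)// re => /esym/eqP; rewrite (negbTE c0).
- move=> x; have := bessel_countable M_lin M_ge0 M1 rho1 ort (bfx x).
  apply: sub_countable; apply: subset_card_le => e /= [Ue rex].
  by split=> //; rewrite -rP.
Qed.

Local Open Scope card_scope.

(** * Cardinal arithmetic *)

Lemma card_le_fun {T : Type} {U : choiceType} (u0 : U) (A : set T) (B : set U) :
  A #<= B -> exists f : T -> U, (forall x, A x -> B (f x)) /\
    forall x y, A x -> A y -> f x = f y -> x = y.
Proof.
pose U' : pointedType := HB.pack U (isPointed.Build U u0).
move=> /(@pcard_leP T U')/injfunPex[f fAB finj]; exists f; split=> // x y Ax Ay.
by apply: finj; rewrite inE.
Qed.

Lemma card_le_of_inj {T U : Type} (f : T -> U) (A : set T) (B : set U) :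
  (forall x, A x -> B (f x)) -> (forall x y, A x -> A y -> f x = f y -> x = y) ->
  A #<= B.
Proof.
move=> fAB finj; apply: (@card_le_trans _ _ _ (f @` A)).
  have /card_esym : (f @` A) #= A.
    by apply: inj_card_eq => x y; rewrite !inE => Ax Ay; exact: finj.
  by rewrite card_eq_le => /andP[].
by apply: subset_card_le => _ [x Ax <-]; exact: fAB.
Qed.

Lemma card_le_of_surj {T U : Type} (P : T -> U) (A : set T) :
  (forall u, exists t, A t /\ P t = u) -> [set: U] #<= A.
Proof.
move=> Psurj; apply: (@card_le_trans _ _ _ (P @` A)); last exact: card_image_le.
by apply: subset_card_le => u _; have [t [At <-]] := Psurj u; exists t.
Qed.

(** If no piece is as large as [V], each [F i] misses a value [h i] in the coordinate [i]; a point
    with coordinates [h] then lies in no piece. *)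
Lemma koenig {T I V : Type} (v0 : V) (P : T -> I -> V) (S : set I) (F : I -> set T) :
  (forall h : I -> V, exists t, forall i, S i -> P t i = h i) ->
  (forall t, exists i, S i /\ F i t) -> exists i, S i /\ [set: V] #<= F i.
Proof.
move=> Psurj Fcov; apply: contrapT => nF.
have /choice[h hP] : forall i, exists v, S i -> forall t, F i t -> P t i <> v.
  move=> i; have [Si|nSi] := pselect (S i); last by exists v0 => /nSi.
  apply: contrapT => /forallNP nv; apply: nF; exists i; split=> //.
  apply: (card_le_of_surj (P := P ^~ i)) => v.
  apply: contrapT => /forallNP nt; apply: (nv v) => _ t Ft Pt; exact: (nt t).
have [t tP] := Psurj h.
have [i [Si Fit]] := Fcov t.
exact: hP Si _ Fit (tP i Si).
Qed.

Section Continuum.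
Context {R : realType}.

Lemma card_real_le_set_nat : [set: R] #<= [set: set nat].
Proof.
apply: (card_le_of_inj (f := fun x : R =>
  [set n | exists q : rat, unpickle n = Some q /\ ratr q < x])) => // x y _ _ xy.
have lt_neq (a b : R) : a < b ->
    [set n | exists q : rat, unpickle n = Some q /\ ratr q < a] <>
    [set n | exists q : rat, unpickle n = Some q /\ ratr q < b].
  move=> /rat_in_itvoo[q]; rewrite in_itv /= => /andP[aq qb] ab.
  have : [set n | exists q : rat, unpickle n = Some q /\ ratr q < a] (pickle q).
    by rewrite ab /=; exists q; rewrite pickleK.
  by move=> [q' []]; rewrite pickleK => -[<-]; rewrite ltNge (ltW aq).
by case: (ltgtP x y) => // /lt_neq; [move=> /(_ xy)|move=> /(_ (esym xy))].
Qed.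

(** Base 3 with digits 0 and 1 leaves gaps, so that distinct sets have distinct sums. *)
Definition ternary (A : set nat) (n : nat) : R :=
  \sum_(i < n) (if `[< A i >] then 3^-1 ^+ i else 0).

Lemma ternaryS A n :
  ternary A n.+1 = ternary A n + (if `[< A n >] then 3^-1 ^+ n else 0).
Proof. by rewrite /ternary big_ord_recr. Qed.

Lemma ternary_le A k n :
  ternary A (k + n) <= ternary A k + 3 / 2 * 3^-1 ^+ k - 3 / 2 * 3^-1 ^+ (k + n).
Proof.
elim: n => [|n IH]; first by rewrite addn0; lra.
rewrite addnS ternaryS exprS.
have : 0 <= 3^-1 ^+ (k + n) :> R by rewrite exprn_ge0// invr_ge0.
case: ifP => _; lra.
Qed.

Lemma card_set_nat_le_real : [set: set nat] #<= [set: R].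
Proof.
pose g A := sup (range (ternary A)).
have pow0 k : 0 <= 3^-1 ^+ k :> R by rewrite exprn_ge0// invr_ge0.
have ub A k : ubound (range (ternary A)) (ternary A k + 3 / 2 * 3^-1 ^+ k).
  move=> _ [n _ <-]; have [kn|nk] := leqP k n.
    have := ternary_le A k (n - k); rewrite subnKC//.
    have := pow0 n; lra.
  have -> : ternary A k = ternary A n + \sum_(n <= i < k) (if `[< A i >] then 3^-1 ^+ i else 0).
    rewrite /ternary.
    rewrite -!(big_mkord xpredT (fun i => if `[< A i >] then 3^-1 ^+ i else 0)).
    by rewrite -big_cat_nat//= ltnW.
  have : 0 <= \sum_(n <= i < k) (if `[< A i >] then 3^-1 ^+ i else 0) :> R.
    by apply: sumr_ge0 => i _; case: ifP.
  have := pow0 k; lra.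
(* At the first difference [m], all later terms of [B] sum to at most [3/2 * 3^-(m+1)], half of the
   term [3^-m] that [A] gains. *)
have g_lt A B m : (forall i, (i < m)%N -> A i <-> B i) -> A m -> ~ B m -> g B < g A.
  move=> AB Am Bm.
  have ABm : ternary A m = ternary B m.
    apply: eq_bigr => i _; congr (if _ then _ else _).
    by apply: asbool_equiv_eq; exact: AB.
  have gA : ternary A m.+1 <= g A.
    apply: ub_le_sup; last by exists m.+1.
    by exists (ternary A 0 + 3 / 2 * 3^-1 ^+ 0); exact: ub.
  have gB : g B <= ternary B m.+1 + 3 / 2 * 3^-1 ^+ m.+1.
    by apply: ge_sup; [exists (ternary B 0), 0%N|exact: ub].
  rewrite (le_lt_trans gB)// (lt_le_trans _ gA)// !ternaryS ABm (asboolT Am) (asboolF Bm).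
  have : 0 < 3^-1 ^+ m :> R by rewrite exprn_gt0// invr_gt0.
  rewrite exprS; lra.
apply: (card_le_of_inj (f := g)) => // A B _ _ gAB.
apply: contrapT => AB.
have exm : exists i, `[< A i >] != `[< B i >].
  apply: contrapT => ne; apply: AB; apply/seteqP; split=> i Ai; apply: contrapT => nB;
    by apply: ne; exists i; case: asboolP => hA; case: asboolP => hB//; tauto.
have [m mAB mmin] := ex_minnP exm.
have below i : (i < m)%N -> A i <-> B i.
  move=> im; have : `[< A i >] == `[< B i >].
    by apply/negPn/negP => /mmin; rewrite leqNgt im.
  by move=> /eqP e; split=> /asboolP; [rewrite e|rewrite -e] => /asboolP.
have [Am|nAm] := pselect (A m).
  have nBm : ~ B m by move=> Bm; move: mAB; rewrite !asboolT.
  by have := g_lt _ _ _ below Am nBm; rewrite gAB ltxx.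
have Bm : B m by apply: contrapT => nBm; move: mAB; rewrite !asboolF.
have := g_lt _ _ m (fun i im => iff_sym (below i im)) Bm nAm.
by rewrite gAB ltxx.
Qed.

End Continuum.

Lemma finite_subset_image {I T : Type} (F : I -> T) (D : set I) (G : set T) :
  finite_set G -> G `<=` F @` D -> exists2 L : set I, finite_set L &
    L `<=` D /\ G `<=` F @` L.
Proof.
move=> Gfin GFD; have [[t0 Gt0]|G0] := pselect (G !=set0); last first.
  by exists set0 => //; split=> // t Gt; case: G0; exists t.
have [i0 Di0 _] := GFD _ Gt0.
have /choice[g gP] : forall t, exists i, G t -> D i /\ F i = t.
  move=> t; have [Gt|nGt] := pselect (G t); last by exists i0.
  by have [i Di Fi] := GFD t Gt; exists i.
exists (g @` G); first exact: finite_image.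
split=> [_ [t Gt <-]|t Gt]; first by have [] := gP t Gt.
by exists (g t); [exists t|have [] := gP t Gt].
Qed.

(** * Almost disjoint coding and the cofinality of the continuum *)

Section Coding.
Context {R : realType} {W : choiceType} (K : set W).
Hypothesis pc : @p_at_least_c R.
Hypothesis K_lt : ~ ([set: R] #<= K).
Hypothesis K_le : K #<= [set: R].
Hypothesis K0 : K !=set0.

(** An embedding would split the continuum into countably many pieces by its second coordinate. By
    Koenig's theorem one piece has full size, and the first coordinate embeds it in [K]. *)
Lemma small_product {J : countType} : ~ ([set: R] #<= K `*` [set: J]).
Proof.
move=> RKJ; apply: K_lt.
have [w0 Kw0] := K0.
have [[j0 _]|nJ] := pselect (exists j : J, True); last first.
  have K00 : K `*` [set: J] `<=` set0 by move=> [w j] _; case: nJ; exists j.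
  have := card_le_trans RKJ (subset_card_le K00); rewrite card_le0 => /eqP R0.
  by have : [set: R] 0 by []; rewrite R0.
have [g [gK ginj]] := card_le_fun (w0, j0) (card_le_trans (card_set_nat_le_real (R := R)) RKJ).
have [||j [_ nj]] := @koenig (set nat) J (set nat) set0
  (fun (A : set nat) j => [set n | A (pickle (j, n))]) setT (fun j => [set A | (g A).2 = j]).
- move=> h; exists [set c | exists j n, c = pickle (j, n) /\ h j n] => j _.
  apply/seteqP; split=> [n /= [j' [n' [/(pcan_inj pickleK)[-> ->]]]]//|n hn /=].
  by exists j, n.
- by move=> A; exists (g A).2.
apply: card_le_trans (card_real_le_set_nat (R := R)) _; apply: card_le_trans nj _.
apply: (card_le_of_inj (f := fst \o g)) => [A _|A B /= Aj Bj /= gAB].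
  by have [] := gK A I.
by apply: ginj => //; move: gAB Aj Bj; case: (g A) (g B) => [x y] [x1 y1] /= -> -> ->.
Qed.

Lemma small_family {J : countType} (F : W * J -> set nat) :
  strong_fip (F @` (K `*` [set: J])) ->
  exists A, pseudointersection (F @` (K `*` [set: J])) A.
Proof.
move=> sF; apply: pc => // RF; apply: (@small_product J).
exact: card_le_trans RF (card_image_le _ _).
Qed.

Section AlmostDisjoint.
Variable a : W -> set nat.
Hypothesis a_inj : forall w w', K w -> K w' -> a w = a w' -> w = w'.

(** The nodes along a branch of the binary tree, namely the characteristic function of [a i.1], in
    the copy numbered [i.2]. Distinct branches share only finitely many nodes. *)
Let node (i : W * nat) (m : nat) : nat :=
  pickle (mkseq (fun k => `[< a i.1 k >]) m, i.2).

Let node_inj i : injective (node i).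
Proof.
by move=> m m' /(pcan_inj pickleK)[/(congr1 size)]; rewrite !size_mkseq.
Qed.

Let node_almost_disjoint i i' : K i.1 -> K i'.1 -> i <> i' ->
  exists b, forall m, (b <= m)%N -> forall m', node i m <> node i' m'.
Proof.
case: i i' => [w n] [w' n'] /= Kw Kw' ii'.
have [nn'|nn'] := eqVneq n n'; last first.
  exists 0%N => m _ m' /(pcan_inj pickleK)[_ nn]; by rewrite nn eqxx in nn'.
have [k kP] : exists k, ~ (a w k <-> a w' k).
  apply/existsNP => aa; apply: ii'; rewrite nn'; congr (_, _).
  by apply: a_inj => //; apply/seteqP; split=> k /aa.
exists k.+1 => m km m' /(pcan_inj pickleK)[e _]; apply: kP.
have mm' : m = m' by have := congr1 size e; rewrite !size_mkseq.
have := congr1 (fun s => nth false s k) e; rewrite -mm' !nth_mkseq//.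
by move=> ab; split=> /asboolP; [rewrite ab|rewrite -ab] => /asboolP.
Qed.

(* Solovay's coding, with the codes ranging over the countable set of pairs
   [(k, s)]: the first component only makes the sets infinite, and the finite
   sets [s] of nodes are glued into one set of nodes. *)
Lemma almost_disjoint_coding (h : W -> set nat) : exists d : set nat,
  forall w, K w -> [set n | infinite_set [set m | d (node (w, n) m)]] = h w.
Proof.
pose code (k : nat) (s : seq nat) := pickle (k, s).
(* For [x = (w, (n, M))], the finite set [s] must meet the branch [(w, n)] at level [M] or later if
   [n] is in [h w], and must avoid that branch otherwise. *)
pose F (x : W * (nat * nat)) : set nat := [set c | exists k s, c = code k s /\
  if `[< h x.1 x.2.1 >]
  then exists2 m, (x.2.2 <= m)%N & node (x.1, x.2.1) m \in s
  else forall m, node (x.1, x.2.1) m \notin s].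
have codeP k s k' s' : code k s = code k' s' -> s = s'.
  by move=> /(pcan_inj pickleK)[].
have [|A [Ainf AF]] := @small_family (nat * nat)%type F.
  move=> G GF Gfin.
  have [_ /finite_seqP[L ->] [LD GL]] := finite_subset_image Gfin GF.
  have LK x : x \in L -> K x.1 by move=> xL; have [] := LD x xL.
  have /choice[b bP] : forall xy : (W * (nat * nat)) * (W * (nat * nat)), exists b,
      K xy.1.1 -> K xy.2.1 -> (xy.1.1, xy.1.2.1) <> (xy.2.1, xy.2.2.1) ->
      forall m, (b <= m)%N -> forall m',
        node (xy.1.1, xy.1.2.1) m <> node (xy.2.1, xy.2.2.1) m'.
    move=> [x y] /=.
    have [[Kx [Ky xy]]|n] := pselect (K x.1 /\ K y.1 /\ (x.1, x.2.1) <> (y.1, y.2.1)).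
      have [b bP] := node_almost_disjoint (i := (x.1, x.2.1))
        (i' := (y.1, y.2.1)) Kx Ky xy.
      by exists b.
    by exists 0%N => Kx Ky xy; case: n.
  (* Level [N] is beyond all required levels and all points where the finitely many branches
     separate, so taking the nodes at level [N] on the wanted branches avoids the others. *)
  pose N := (\max_(x <- L) x.2.2 + \max_(x <- L) \max_(y <- L) b (x, y))%N.
  have N1 x : x \in L -> (x.2.2 <= N)%N.
    move=> xL; rewrite /N (leq_trans _ (leq_addr _ _))//.
    exact: (leq_bigmax_seq (P := xpredT) (F := fun x : W * (nat * nat) => x.2.2)).
  have N2 x y : x \in L -> y \in L -> (b (x, y) <= N)%N.
    move=> xL yL; rewrite /N (leq_trans _ (leq_addl _ _))//.
    apply: leq_trans (leq_bigmax_seq (P := xpredT)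
      (F := fun x => \max_(y <- L) b (x, y)) x xL isT).
    exact: (leq_bigmax_seq (P := xpredT) (F := fun y => b (x, y))).
  pose s := [seq node (x.1, x.2.1) N | x <- L & `[< h x.1 x.2.1 >]].
  have Gs k : (\bigcap_(B in G) B) (code k s).
    move=> B /GL[x xL <-]; exists k, s; split=> //; case: asboolP => hx.
      exists N; first exact: N1.
      by apply/mapP; exists x => //; rewrite mem_filter xL andbT; exact/asboolP.
    move=> m; apply/negP => /mapP[y]; rewrite mem_filter => /andP[/asboolP hy yL].
    move=> /esym; apply: (bP (y, x)) => //=; [exact: LK|exact: LK| |exact: N2].
    by move=> [e1 e2]; apply: hx; rewrite -e1 -e2.
  move=> fin; apply: infinite_nat.
  have fin' : finite_set (code^~ s @` [set: nat]).
    by apply: sub_finite_set fin => _ [k _ <-]; exact: Gs.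
  apply: sub_finite_set (finite_preimage (f := code^~ s) _ fin').
    by move=> k _; exists k.
  by move=> k k' _ _ /(pcan_inj pickleK)[].
exists [set x | exists k s, A (code k s) /\ x \in s] => w Kw.
apply/seteqP; split=> n /=.
  (* All but finitely many codes in [A] avoid the branch, and each exception contributes finitely
     many nodes. *)
  move=> dinf; apply: contrapT => nhn; apply: dinf.
  have Ffin : finite_set (A `\` F (w, (n, 0%N))) by apply: AF; exists (w, (n, 0%N)).
  pose dec c := (odflt (0%N, [::]) (unpickle c) : nat * seq nat).2.
  apply: sub_finite_set (bigcup_finite (F := fun c => [set m | node (w, n) m \in dec c]) Ffin _).
    move=> m [k [s [Aks ms]]]; exists (code k s); last by rewrite /= /dec pickleK.
    split=> // -[k' [s' [/codeP <-]]] /=; rewrite asboolF// => /(_ m).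
    by rewrite ms.
  move=> c _; apply: (finite_preimage (f := node (w, n)) (B := [set` dec c])).
    by move=> m m' _ _; exact: node_inj.
  exact: finite_seq.
move=> hn; apply/infinite_set_natP => M.
have Ffin : finite_set (A `\` F (w, (n, M))) by apply: AF; exists (w, (n, M)).
have [c [Ac Fc]] : exists c, A c /\ F (w, (n, M)) c.
  apply: contrapT => ne; apply: Ainf; apply: sub_finite_set Ffin => c Ac.
  by split=> // Fc; apply: ne; exists c.
have [k [s [cE]]] := Fc; rewrite /= asboolT// => -[m Mm ms].
by exists m; split=> //; exists k, s; rewrite -cE.
Qed.

End AlmostDisjoint.

(** By the coding, a single subset of the integers can prescribe a set of integers for each [w] in
    [K]; this is the surjectivity required by Koenig's theorem. *)
Lemma continuum_cofinality (F : W -> set R) :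
  (forall x, exists w, K w /\ F w x) -> exists w, K w /\ [set: R] #<= F w.
Proof.
move=> Fcov.
have [g [_ ginj]] := card_le_fun (0 : R) (card_set_nat_le_real (R := R)).
have [a [_ a_inj]] := card_le_fun (set0 : set nat)
  (card_le_trans K_le (card_real_le_set_nat (R := R))).
have [||w [Kw RF]] := @koenig (set nat) W (set nat) set0
  (fun d w => [set n | infinite_set [set m | d (pickle (mkseq (fun k => `[< a w k >]) m, n))]])
  K (fun w => g @^-1` F w).
- by move=> h; have [d dP] := almost_disjoint_coding a_inj h; exists d.
- by move=> A; exact: Fcov.
exists w; split=> //; apply: card_le_trans (card_real_le_set_nat (R := R)) _.
apply: card_le_trans RF _; apply: (card_le_of_inj (f := g)) => // A B _ _.
exact: ginj.
Qed.

End Coding.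

(** A piece not equinumerous with [K] is not cofinal, so some [b w] lies above it. As the pieces
    cover [K], the points [b w] are cofinal, and regularity gives at least [|K|] of them. *)
Lemma regular_cover {T W : choiceType} (K : set T) (L : set W) (F : W -> set T) :
  regular_cardinal K -> (forall w, F w `<=` K) ->
  (forall x, K x -> exists w, L w /\ F w x) ->
  (exists w, L w /\ F w #= K) \/ K #<= L.
Proof.
move=> [_ [le [[lewo _] lereg]]] FK Fcov.
have [?|nF] := pselect (exists w, L w /\ F w #= K); first by left.
right; have [[k0 Kk0]|K0] := pselect (K !=set0); last first.
  by rewrite (_ : K = set0) ?card_ge0// -subset0 => x Kx; case: K0; exists x.
have /choice[b bP] : forall w, exists x, K x /\ (L w -> forall y, F w y -> ~ le x y).
  move=> w; have [Lw|nLw] := pselect (L w); last by exists k0; split.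
  apply: contrapT => /forallNP nx; apply: nF; exists w; split=> //.
  apply: lereg; split; [exact: FK|move=> x Kx]; apply: contrapT => nle.
  by apply: (nx x); split=> // _ y Fy xy; apply: nle; exists y.
have bcof : cofinal K le (b @` L).
  split; first by move=> _ [w _ <-]; have [] := bP w.
  move=> x Kx; have [w [Lw Fx]] := Fcov x Kx; exists (b w); first by exists w.
  have [Kb /(_ Lw x Fx) nle] := bP w.
  have /orP[//|//] := wochoice.wo_chainW lewo (mem_set Kx) (mem_set Kb).
have := lereg _ bcof; rewrite card_eq_le => /andP[_ /card_le_trans]; apply.
exact: card_image_le.
Qed.

(** * Zero sets of functionals and overcomplete sets *)

Lemma dense_span_annihilator {R : realType} {X : normedModType R} (Z : set X)
    (f : dual X) : dense (linear_span Z) -> (forall z, Z z -> f z = 0) -> f = 0.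
Proof.
move=> Zd fZ; apply/val_inj/funext => x; apply: contrapT => /eqP fx.
have fx0 : 0 < `|f x| by rewrite normr_gt0.
(* For [v] in the span within this radius, [|f x| = |f (x - v)|] would be smaller than [|f x|]. *)
have e0 : 0 < `|f x| / (`|f| + 1) by rewrite divr_gt0// ltr_wpDl.
have [v [xv [n [a [z [Zz vE]]]]]] :
    ball x (`|f x| / (`|f| + 1)) `&` linear_span Z !=set0.
  by apply: Zd; [exists x; exact: ballxx|exact: ball_open].
have fv : f v = 0.
  rewrite vE linear_sum big1// => i _.
  by rewrite linearZ /= fZ ?scaler0.
move: xv; rewrite -ball_normE /= ltr_pdivlMr ?ltr_wpDl// ltNge => /negP; apply.
have fB : f (x - v) = f x - f v by rewrite linearB.
have -> : f x = f (x - v) by rewrite fB fv subr0.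
rewrite (le_trans (dual_le _ _))// mulrC; apply: ler_wpM2l => //.
by rewrite lerDl.
Qed.

Lemma density_card_eq {R : realType} {X : normedModType R} {T U : Type}
    (A : set T) (B : set U) : has_density X A -> has_density X B -> A #= B.
Proof.
move=> [[D Dd DA] Amin] [[E Ed EB] Bmin]; rewrite card_eq_le; apply/andP; split.
  apply: card_le_trans (Amin _ Ed) _.
  by move: EB; rewrite card_eq_le => /andP[].
apply: card_le_trans (Bmin _ Dd) _.
by move: DA; rewrite card_eq_le => /andP[].
Qed.

(** [omega1] embeds in the uncountable index set. Only countably many of the functionals are nonzero
    at a given [x], so some member of [omega1] gives zero there. *)
Lemma aleph1_functionals {R : realType} {W : choiceType} (omega1 : set W)
    {X : completeNormedModType R} : is_aleph1 omega1 -> ~ reflexive_space X ->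
  grothendieck_space X ->
  exists r : W -> dual X, (forall w, omega1 w -> r w != 0) /\
    forall x, exists w, omega1 w /\ r w x = 0.
Proof.
move=> [omega1_unc omega1_min] nrefl Xgr.
have [I [U [r [Uunc r0 rcount]]]] := grothendieck_countable_support nrefl Xgr.
have [i0 _] : U !=set0.
  apply: contrapT => U0; apply: Uunc; rewrite (_ : U = set0)// -subset0 => i Ui.
  by case: U0; exists i.
have [phi [phiU phi_inj]] := card_le_fun i0 (omega1_min _ _ Uunc).
exists (r \o phi); split=> [w /phiU|x]; first exact: r0.
apply: contrapT => /forallNP nw; apply: omega1_unc.
apply: sub_countable (rcount x); apply: (card_le_of_inj (f := phi)) => // w ow.
split; first exact: phiU.
by apply/eqP => rx; apply: (nw w).
Qed.

Lemma p_at_least_c_of_eq {R : realType} :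
  is_pseudointersection_number [set: R] -> @p_at_least_c R.
Proof.
move=> [_ pmin] F Fs nRF; apply: contrapT => nA; apply: nRF.
by apply: pmin; split.
Qed.

Lemma no_full_zero_set {R : realType} {X : normedModType R} {T : choiceType}
    (Y : set X) (K : set T) (g : T -> X) (f : dual X) :
  overcomplete Y -> set_bij K Y g -> f != 0 ->
  ~ ([set k | K k /\ f (g k) = 0] #= K).
Proof.
move=> [_ Yover] gbij /eqP f0 Fcard; apply: f0.
pose Z := g @` [set k | K k /\ f (g k) = 0].
have [gK ginj _] := gbij.
apply: (@dense_span_annihilator _ _ Z); last by move=> _ [k [_ fk] <-].
apply: Yover; first by move=> _ [k [Kk _] <-]; exact: gK.
have ZF : Z #= [set k | K k /\ f (g k) = 0].
  apply: inj_card_eq => k k'; rewrite !inE => -[Kk _] [Kk' _].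
  by apply: ginj; rewrite inE.
have KY : K #= Y by apply/card_set_bijP; exists g.
exact: card_eq_trans (card_eq_trans ZF Fcard) KY.
Qed.

Theorem corollary34 (R : realType)
  (p_eq_c : is_pseudointersection_number [set: R])
  (W : choiceType) (omega1 : set W) (omega1P : is_aleph1 omega1)
  (omega1_lt_c : card_lt omega1 [set: R])
  (X : completeNormedModType R) (Xinf : infinite_dimensional X)
  (Xnonrefl : ~ reflexive_space X) (Xgr : grothendieck_space X) :
  (forall (T : choiceType) (K : set T),
      has_density X K -> regular_cardinal K ->
      ~ exists Y : set X, overcomplete Y) /\
  (has_density X [set: R] -> ~ exists Y : set X, overcomplete Y).
Proof.
have pc := p_at_least_c_of_eq p_eq_c.
have [omega1_le omega1_nle] := omega1_lt_c.
have [r [r0 rcov]] := aleph1_functionals omega1P Xnonrefl Xgr.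
split=> [T K KX Kreg [Y Yover]|RX [Y Yover]].
  have [YX _] := Yover.
  have /card_set_bijP[g gbij] := density_card_eq KX YX.
  pose F w := [set k | K k /\ r w (g k) = 0].
  have FK w : F w `<=` K by move=> k [].
  have Fcov k : K k -> exists w, omega1 w /\ F w k.
    by move=> Kk; have [w [ow rw]] := rcov (g k); exists w.
  have [[w [ow Fw]]|Kom] := regular_cover Kreg FK Fcov.
    exact: (no_full_zero_set Yover gbij (r0 w ow) Fw).
  (* In the remaining case the density is at most omega_1, hence below the continuum, which the
     pseudointersection argument excludes. *)
  have [f [f1 fdiv]] := grothendieck_convex_divergent Xnonrefl Xgr.
  have [[D Dd DK] _] := KX.
  have Dom : D #<= omega1.
    by apply: card_le_trans Kom; move: DK; rewrite card_eq_le => /andP[].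
  apply: (@small_product R X D _ _ nat).
  - by move=> RD; apply: omega1_nle; exact: card_le_trans RD Dom.
  - by have [x [_ Dx]] := Dd setT (ex_intro _ 0 I) openT; exists x.
  - exact: convex_divergent_density pc f1 fdiv Dd.
have [YX _] := Yover.
have /card_set_bijP[g gbij] := density_card_eq RX YX.
(* Here the cofinality of the continuum, larger than omega_1, replaces regularity. *)
have [|x|w [ow Fw]] := continuum_cofinality pc omega1_nle omega1_le _
  (F := fun w => [set x | [set: R] x /\ r w (g x) = 0]).
- apply: contrapT => o0; case: omega1P => + _; apply.
  by rewrite (_ : omega1 = set0)// -subset0 => w ow; case: o0; exists w.
- by have [w [ow rw]] := rcov (g x); exists w.
apply: (no_full_zero_set Yover gbij (r0 w ow)).
by rewrite card_eq_le Fw andbT; apply: subset_card_le.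
Qed.
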